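(* Let $n\ge1$, let $-\infty<x_1<\cdots<x_{2n}<\infty$ and let $x_1^a<\cdots<x_{2n}^a$ be $2n$ vertices in $a\mathbb{Z}$ satisfying $\lim_{a\to0}x_j^a=x_j$ for $1\le j\le2n$. Then $$\langle\sigma_{x_1}\cdots\sigma_{x_{2n}}\rangle^{\mathbf f}_{\mathbb{H}}:=\lim_{a\to0}a^{-n}\times\mathbb{E}^{(a,\mathbf f)}_{\mathbb{H}}\big[\sigma_{x_1^a}\cdots\sigma_{x_{2n}^a}\big]=C_4^n\,\mathrm{Pf}\Big[\frac1{x_k-x_j}\Big]_{j,k=1}^{2n}=C_4^n\sum_{\varpi\in\Pi_n}\mathrm{sgn}(\varpi)\prod_{\{c,d\}\in\varpi}\frac1{x_d-x_c}.$$ As a consequence, for each $j\in\{1,2,\ldots,2n\}$, the function $(x_1,\ldots,x_{2n})\mapsto\langle\sigma_{x_1}\cdots\sigma_{x_{2n}}\rangle^{\mathbf f}_{\mathbb{H}}$ is annihilated by the differential operator $$\frac32\partial_j^2+\sum_{k\ne j}\Big(\frac{2}{x_k-x_j}\partial_k-\frac1{(x_k-x_j)^2}\Big).$$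
   Context: $\mathbb{E}^{(a,\mathbf f)}_{\mathbb{H}}$ is the expectation of the (infinite-volume) critical Ising model on $a(\overline{\mathbb{H}}\cap\mathbb{Z}^2)$, the square lattice of mesh $a$ in the closed upper half-plane, with free boundary condition. On a finite graph $G$, this model is the probability measure on $\sigma\in\{-1,+1\}^{V(G)}$ proportional to $\exp(\beta_c\sum_{\langle v,w\rangle\in E(G)}\sigma_v\sigma_w)$ with $\beta_c=\frac12\log(1+\sqrt2)$. $\Pi_n$ is the set of pair partitions $\varpi=\{\{c_1,d_1\},\ldots,\{c_n,d_n\}\}$ of $\{1,\ldots,2n\}$ into $n$ disjoint two-element subsets, with the convention $c_1<\cdots<c_n$ and $c_j<d_j$ for all $j$. $\mathrm{sgn}(\varpi)$ is the sign of the product $\prod(c-e)(c-f)(d-e)(d-f)$ over pairs of distinct elements $\{c,d\},\{e,f\}\in\varpi$. In the Pfaffian, diagonal entries are $0$. $C_4\in(0,\infty)$ is the constant for which $\lim_{a\to0}a^{-1}\,\mathbb{P}^a_{\mathbb{H}}[x_1^a\longleftrightarrow x_2^a]=C_4|x_1-x_2|^{-1}$ for all distinct $x_1,x_2\in\mathbb{R}$ and boundary vertices $x_j^a\to x_j$, where $\mathbb{P}^a_{\mathbb{H}}$ is the critical FK-Ising measure on the upper half-plane lattice of mesh $a$ with free boundary condition (random-cluster measure with weight proportional to $p^{\#\text{open edges}}(1-p)^{\#\text{closed edges}}q^{\#\text{clusters}}$ on finite graphs, $q=2$, $p=\frac{\sqrt2}{1+\sqrt2}$, in infinite volume), and $x\longleftrightarrow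 y$ means that $x,y$ are joined by a path of open edges. *)

(* Defs.v *)
From mathcomp Require Import all_boot all_order all_algebra all_fingroup finmap.
From mathcomp Require Import all_classical all_reals all_analysis.
Set Implicit Arguments.
Unset Strict Implicit.
Unset Printing Implicit Defensive.
Import Order.TTheory GRing.Theory Num.Theory.
Import numFieldNormedType.Exports.
Local Open Scope classical_set_scope.
Local Open Scope ring_scope.

(* (k, l) is the vertex a(k + il) of the lattice of mesh a in the closed upper
   half-plane; as an abstract graph the lattice does not depend on a. *)
Definition vertex : Type := (int * nat)%type.

Definition bdry (k : int) : vertex := (k, 0%N).

(* (v, false) is the edge from v to v + 1, (v, true) the edge from v to v + i;
   every edge of the lattice is listed exactly once. *)
Definition edge : Type := (vertex * bool)%type.

Definition src (e : edge) : vertex := e.1.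

Definition tgt (e : edge) : vertex :=
  if e.2 then (e.1.1, e.1.2.+1) else (e.1.1 + 1, e.1.2).

Definition box (N : nat) : {fset vertex} :=
  [fset ((Posz i - Posz N, j) : int * nat) | i in iota 0 N.*2.+1, j in iota 0 N.+1]%fset.

Definition edges (L : {fset vertex}) : {fset edge} :=
  [fset e in (L `*` [fset false; true])%fset | tgt e \in L]%fset.

(* Configurations indexed by I, with the product sigma-algebra. *)
Definition coordinate_events (I : Type) : set (set (I -> bool)) :=
  [set A | exists (i : I) (b : bool), A = [set w | w i = b]].

Notation config I := (g_sigma_algebraType (@coordinate_events I)).

Definition cylinder (I : choiceType) (S : {fset I}) (h : I -> bool) :
    set (I -> bool) :=
  [set w | forall i, i \in S -> w i = h i].

(* The value false outside L is a dummy: the weights below do not see it. *)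
Definition extend (I : choiceType) (L : {fset I}) (s : {ffun L -> bool}) :
    I -> bool :=
  fun i => if insub i is Some u then s u else false.

Definition gibbs (R : realType) (I : choiceType) (L : {fset I})
    (weight : (I -> bool) -> R) (A : set (I -> bool)) : R :=
  (\sum_(s : {ffun L -> bool}) weight (extend s) * \1_A (extend s)) /
  (\sum_(s : {ffun L -> bool}) weight (extend s)).

(* P is the weak limit of the finite-volume measures mu N. *)
Definition infinite_volume_limit (R : realType) (I : choiceType)
    (mu : nat -> set (I -> bool) -> R) (P : probability (config I) R) : Prop :=
  forall (S : {fset I}) (h : I -> bool),
    mu N (cylinder S h) @[N --> \oo] --> fine (P (cylinder S h)).

Section Ising.
Variable R : realType.

Definition spin (b : bool) : R := if b then 1 else -1.

Definition beta_c : R := ln (1 + Num.sqrt 2) / 2.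

Definition ising_weight (L : {fset vertex}) (s : vertex -> bool) : R :=
  expR (beta_c * \sum_(e : edges L) spin (s (src (val e))) * spin (s (tgt (val e)))).

Definition ising_free (L : {fset vertex}) : set (vertex -> bool) -> R :=
  gibbs L (ising_weight L).

Definition half_plane_ising_free (P : probability (config vertex) R) : Prop :=
  infinite_volume_limit (fun N => ising_free (box N)) P.

End Ising.

Section FK.
Variable R : realType.

Definition open_adjacent (w : edge -> bool) : rel vertex := fun u v =>
  [exists b : bool, (tgt (u, b) == v) && w (u, b) || (tgt (v, b) == u) && w (v, b)].

Definition p_c : R := Num.sqrt 2 / (1 + Num.sqrt 2).

(* The clusters are the connected components of (L, open edges), isolated
   vertices included. *)
Definition num_clusters (L : {fset vertex}) (w : edge -> bool) : nat :=
  n_comp [rel u v : L | open_adjacent w (val u) (val v)] predT.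

Definition fk_weight (L : {fset vertex}) (w : edge -> bool) : R :=
  p_c ^+ #|[pred e : edges L | w (val e)]| *
  (1 - p_c) ^+ #|[pred e : edges L | ~~ w (val e)]| *
  2 ^+ num_clusters L w.

Definition fk_free (L : {fset vertex}) : set (edge -> bool) -> R :=
  gibbs (edges L) (fk_weight L).

Definition half_plane_fk_free (P : probability (config edge) R) : Prop :=
  infinite_volume_limit (fun N => fk_free (box N)) P.

Definition connected_event (u v : vertex) : set (config edge) :=
  [set w | exists p : seq vertex, path (open_adjacent w) u p /\ last u p = v].

(* a k(a) -> x as a decreases to 0: the boundary vertices a k(a) approximate x. *)
Definition approximates (k : R -> int) (x : R) : Prop :=
  a * (k a)%:~R @[a --> 0^'+] --> x.

Definition is_C4 (P : probability (config edge) R) (C4 : R) : Prop :=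
  0 < C4 /\
  forall (x1 x2 : R) (k1 k2 : R -> int), x1 != x2 ->
    approximates k1 x1 -> approximates k2 x2 ->
    a^-1 * fine (P (connected_event (bdry (k1 a)) (bdry (k2 a))))
      @[a --> 0^'+] --> C4 * `|x1 - x2|^-1.

End FK.

Section Pfaffian.
Variables (R : realType) (n : nat).

Lemma double_lt (i : 'I_n) : (i.*2 < n.*2)%N.
Proof. by rewrite ltn_double. Qed.

Lemma doubleS_lt (i : 'I_n) : (i.*2.+1 < n.*2)%N.
Proof. by rewrite ltn_Sdouble. Qed.

Definition pfaffian (A : 'M[R]_(n.*2)) : R :=
  (2 ^+ n * n`!%:R)^-1 *
  \sum_(s : 'S_(n.*2)) (-1) ^+ s *
    \prod_(i < n) A (s (Ordinal (double_lt i))) (s (Ordinal (doubleS_lt i))).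

Definition pair_partitions : {set {set {set 'I_(n.*2)}}} :=
  [set w : {set {set 'I_(n.*2)}} |
    finset.partition w [set: 'I_(n.*2)] & [forall B in w, #|B| == 2%N]]%SET.

(* (c, d) with c < d and {c, d} in w. *)
Definition is_pair (w : {set {set 'I_(n.*2)}}) (p : 'I_(n.*2) * 'I_(n.*2)) : bool :=
  (p.1 < p.2)%N && ([set p.1; p.2]%SET \in w).

(* The unordered pairs of distinct elements {c, d}, {e, f} of w are listed once
   each, by requiring c < e: over ordered pairs the product would always be
   positive. *)
Definition pp_sgn (w : {set {set 'I_(n.*2)}}) : int :=
  Num.sg (\prod_(p | is_pair w p) \prod_(q | is_pair w q && (p.1 < q.1)%N)
    ((Posz p.1 - Posz q.1) * (Posz p.1 - Posz q.2) *
     (Posz p.2 - Posz q.1) * (Posz p.2 - Posz q.2))).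

Definition increasing (x : 'rV[R]_(n.*2)) : Prop :=
  forall i j : 'I_(n.*2), (i < j)%N -> x 0 i < x 0 j.

Definition cauchy_mx (x : 'rV[R]_(n.*2)) : 'M[R]_(n.*2) :=
  \matrix_(j, k) (if j == k then 0 else (x 0 k - x 0 j)^-1).

Definition pair_partition_sum (x : 'rV[R]_(n.*2)) : R :=
  \sum_(w in pair_partitions)
    (pp_sgn w)%:~R * \prod_(p | is_pair w p) (x 0 p.2 - x 0 p.1)^-1.

End Pfaffian.

Definition scaled_correlation (R : realType) (P : probability (config vertex) R)
    (n : nat) (k : 'I_(n.*2) -> R -> int) (a : R) : R :=
  a ^- n * fine ('E_P[fun s : config vertex =>
                       \prod_(j < n.*2) spin R (s (bdry (k j a)))]).

Definition bpz_operator (R : realType) (m : nat) (j : 'I_m) (F : 'rV[R]_m -> R)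
    (x : 'rV[R]_m) : R :=
  3 / 2 * 'D_('e_j) ('D_('e_j) F) x +
  \sum_(k < m | k != j)
    (2 / (x 0 k - x 0 j) * 'D_('e_k) F x - (x 0 k - x 0 j) ^- 2 * F x).

(* Main.v *)
Require Import Defs.
From mathcomp Require Import all_boot all_order all_algebra all_fingroup finmap.
From mathcomp Require Import all_classical all_reals all_analysis.
From mathcomp Require Import ring lra zify.
Set Implicit Arguments.
Unset Strict Implicit.
Unset Printing Implicit Defensive.
Import Order.TTheory GRing.Theory Num.Theory.
Import numFieldNormedType.Exports.
Local Open Scope classical_set_scope.
Local Open Scope ring_scope.

(** Build the box row by row, keeping track of the correlations f(A) of the spins on the
    current lowest row. Adding an edge between neighbours of that row replaces f by
    c f(A) + d f(A + {i, i+1}), and adding a vertical edge to a new vertex rescales f; both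
    operations preserve the Grassmann-Pluecker relations, i.e. the fact that f is a
    Gaussian fermionic state. These relations contain the expansion of a Pfaffian along its
    first row, so the correlations of the spins of the bottom row are Pfaffians of the
    two-point function, in finite and then in infinite volume.

    By the Edwards-Sokal coupling the two-point function is the FK connection probability
    in finite volume. The four functions theorem, applied to the supermodular FK weights,
    shows that the free measures increase with the box, which allows one to pass to the
    limit although a connection is not a local event. The definition of C4 then gives the
    scaling limit, by continuity of the Pfaffian.

    In the differential equation, the terms of a pairing s in which j is paired with l
    cancel for k = l, and the remaining ones sum to r_k (r_{s k} - r_k) over the other
    points k, where r_k = 1 / (x_k - x_j); exchanging the partners of j and k reverses the
    sign of the pairing and preserves this term. *)

(** * Sums over configurations *)

(** Wick's rule holds for spins in a fixed order along one line, not for bulk spins, so a bulk spin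
    has to be summed out once the line has moved past it. Planarity enters through signs only: the
    Plücker signs count the indices below a given one, and an edge between neighbours i, i+1 is
    harmless because no index separates them. The relations are quadratic and homogeneous, so a
    partition function is divided out only at the end, where f of the empty set is positive.

    The passage to infinite volume is a squeeze between local events. The Ising expectation in a box
    is the probability of being connected inside that box, which a larger free measure can only
    increase; conversely, being connected inside a smaller box is a smaller event.

    In the differential equation, each derivative of a pairing term is the term times a simple pole,
    and the derivative of that pole is its square. For the partner of j this gives the coefficients
    3/2 times 2, then -2 and -1, whose sum is zero; this is where 3/2 comes from. *)

Definition update (I : eqType) (i : I) (b : bool) (w : I -> bool) : I -> bool :=
  fun j => if j == i then b else w j.

(** Configurations stay functions on all of [I], so that sites can be updated, flipped or moved
    between lists without dependent types; recursion on the list allows induction site by site.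
    [sum_extend] links this to sums over finite functions. *)
Fixpoint csum (R : nmodType) (I : eqType) (r : seq I) (g : (I -> bool) -> R) : R :=
  if r is i :: r' then csum r' (fun w => g (update i false w) + g (update i true w))
  else g (fun=> false).

Section UpdateTheory.
Variable I : eqType.
Implicit Types (i j : I) (w : I -> bool).

Lemma update_same i b w : update i b w i = b.
Proof. by rewrite /update eqxx. Qed.

Lemma update_other i j b w : j != i -> update i b w j = w j.
Proof. by rewrite /update => /negbTE ->. Qed.

Lemma update_map2 (op : bool -> bool -> bool) i b c w w' :
  (fun j => op (update i b w j) (update i c w' j)) =
  update i (op b c) (fun j => op (w j) (w' j)).
Proof. by apply/funext => j; rewrite /update; case: eqP. Qed.

Lemma update_id i w b : w i = b -> update i b w = w.
Proof. by move=> wi; apply/funext => j; rewrite /update; case: eqP => // ->. Qed.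

End UpdateTheory.

Section ConfigurationSum.
Variables (R : comNzRingType) (I : eqType).
Implicit Types (r : seq I) (g h : (I -> bool) -> R).

Lemma eq_csum r g h : g =1 h -> csum r g = csum r h.
Proof. by move=> /funext ->. Qed.

(* Only configurations that vanish outside r are summed over. *)
Lemma eq_csum_supp r g h :
  (forall w : I -> bool, (forall i, w i -> i \in r) -> g w = h w) -> csum r g = csum r h.
Proof.
elim: r g h => [|i r IH] g h gh /=; first by apply: gh.
by apply: IH => w wr; congr (_ + _); apply: gh => j; rewrite /update inE;
  case: eqP => //= _ /wr.
Qed.

Lemma csumD r g h : csum r (fun w => g w + h w) = csum r g + csum r h.
Proof.
elim: r g h => [//|i r IH] g h /=; rewrite -IH.
by apply: eq_csum => w; rewrite addrACA.
Qed.

Lemma csumZ r (c : R) g : csum r (fun w => c * g w) = c * csum r g.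
Proof.
elim: r g => [//|i r IH] g /=; rewrite -IH.
by apply: eq_csum => w; rewrite mulrDr.
Qed.

Lemma csumZr r (c : R) g : csum r (fun w => g w * c) = csum r g * c.
Proof. by rewrite mulrC -csumZ; apply: eq_csum => w; rewrite mulrC. Qed.

Lemma csum0 r : csum r (fun=> 0) = 0 :> R.
Proof. by elim: r => //= i r; rewrite addr0. Qed.

Lemma csum_const r (c : R) : csum r (fun=> c) = 2 ^+ size r * c.
Proof.
elim: r c => [|i r IH] c /=; first by rewrite expr0 mul1r.
by rewrite IH exprSr -mulrA; congr (_ * _); ring.
Qed.

Lemma csum_sum (J : Type) (s : seq J) (P : pred J) r (F : J -> (I -> bool) -> R) :
  csum r (fun w => \sum_(j <- s | P j) F j w) = \sum_(j <- s | P j) csum r (F j).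
Proof.
elim: s => [|j s IH].
  rewrite big_nil -[RHS](csum0 r); apply: eq_csum => w; exact: big_nil.
rewrite big_cons -IH; case: ifP => Pj.
  by rewrite -csumD; apply: eq_csum => w; rewrite big_cons Pj.
by apply: eq_csum => w; rewrite big_cons Pj.
Qed.

Lemma csum_cat r1 r2 g :
  csum (r1 ++ r2) g =
  csum r2 (fun w2 => csum r1 (fun w1 => g (fun i => if i \in r1 then w1 i else w2 i))).
Proof.
elim: r1 g => [|i r IH] g /=; first by [].
rewrite IH; apply: eq_csum => w2; apply: eq_csum => w1.
have E b : update i b (fun j => if j \in r then w1 j else w2 j) =
           (fun j => if j \in i :: r then update i b w1 j else w2 j).
  by apply/funext => j; rewrite /update inE; case: (j == i).
by rewrite !E.
Qed.

(** Adding [C] permutes the configurations on [r]. This change of variables serves the spin-flip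
    cancellations, the cluster flip and the coset argument for cluster counts. *)
Lemma csum_xor r (C : I -> bool) g : uniq r -> (forall i, C i -> i \in r) ->
  csum r (fun w => g (fun i => w i (+) C i)) = csum r g.
Proof.
elim: r g C => [|i r IH] g C /= => [_ C0|/andP[ir ur] Cr].
  by congr g; apply/funext => i; case: (C i) (C0 i) => // /(_ isT).
set C' := update i false C.
have Cup b w : (fun j => update i b w j (+) C j) =
               update i (b (+) C i) (fun j => w j (+) C' j).
  by apply/funext => j; rewrite /C' /update; case: eqP => [->|].
rewrite -[RHS](IH _ C') //; last first.
  move=> j; rewrite /C' /update; case: (eqVneq j i) => // ji /Cr.
  by rewrite inE (negbTE ji).
apply: eq_csum => w; rewrite !Cup.
by case: (C i) => //=; rewrite addrC.
Qed.

Lemma csum_prod r (phi : I -> bool -> R) : uniq r ->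
  csum r (fun w => \prod_(i <- r) phi i (w i)) =
  \prod_(i <- r) (phi i false + phi i true).
Proof.
elim: r => [|i r IH] /=; first by rewrite !big_nil.
case/andP => ir ur; rewrite big_cons -IH // -csumZ; apply: eq_csum => w.
rewrite !big_cons !update_same mulrDl.
by congr (_ * _ + _ * _); apply: eq_big_seq => j jr; rewrite update_other //;
  apply: contraNneq ir => <-.
Qed.

(** Each site of [r2] is invisible to [g] and contributes a factor 2. *)
Lemma csum_local r1 r2 g :
  {in r2, forall i w b, g (update i b w) = g w} ->
  csum (r1 ++ r2) g = 2 ^+ size r2 * csum r1 g.
Proof.
move=> gloc; rewrite csum_cat -csum_const; apply: eq_csum_supp => w2 w2r2.
(* The support of [w2] is generalised to a sublist [s] of [r2], on which the induction resets one
   value of [w2] at a time. *)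
have {w2r2}: exists2 s : seq I, {subset s <= r2} & forall i, w2 i -> i \in s by exists r2.
case=> s; elim: s w2 => [|i s IH] w2 sr2 w2s.
  apply: eq_csum_supp => w w1; congr g; apply/funext => i.
  case: ifP => // ir; case: (w2 i) (w2s i) => [/(_ isT)//|_].
  by case: (w i) (w1 i) => // /(_ isT); rewrite ir.
rewrite -(IH (update i false w2)).
- apply: eq_csum => w; case: (boolP (i \in r1)) => ir1.
    congr g; apply/funext => j; rewrite /update.
    by case: (eqVneq j i) => // ->; rewrite ir1.
  rewrite -(gloc i _ _ false); last by apply: sr2; rewrite mem_head.
  congr g; apply/funext => j; rewrite /update.
  by case: (eqVneq j i) => // ->; rewrite (negbTE ir1).
- by move=> j js; apply: sr2; rewrite inE js orbT.
- move=> j; rewrite /update; case: (eqVneq j i) => // ji /w2s.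
  by rewrite inE (negbTE ji).
Qed.

End ConfigurationSum.

Lemma csum_exchange (R : comNzRingType) (I J : eqType) (r : seq I) (r' : seq J)
    (g : (I -> bool) -> (J -> bool) -> R) :
  csum r (fun w => csum r' (g w)) = csum r' (fun s => csum r (g^~ s)).
Proof.
elim: r g => [//|i r IH] g /=.
by rewrite -IH; apply: eq_csum => w; rewrite -csumD.
Qed.

Section OrderedConfigurationSum.
Variables (R : realFieldType) (I : eqType).
Implicit Types (r : seq I) (g h : (I -> bool) -> R).

Lemma csum_ge0 r g : (forall w, 0 <= g w) -> 0 <= csum r g.
Proof. by elim: r g => [|i r IH] g g0 //=; apply: IH => w; rewrite addr_ge0. Qed.

Lemma csum_gt0 r g : (forall w, 0 < g w) -> 0 < csum r g.
Proof. by elim: r g => [|i r IH] g g0 //=; apply: IH => w; rewrite addr_gt0. Qed.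

Lemma ler_csum r g h : (forall w, g w <= h w) -> csum r g <= csum r h.
Proof. by elim: r g h => [|i r IH] g h gh //=; apply: IH => w; rewrite lerD. Qed.

(** Put P = a0 b1, Q = a1 b0, r = c1 d0, t = c0 d1. Both P and Q are at most r, and P Q is at most r
    t, so for r > 0 expanding (r - P)(r - Q) >= 0 gives P + Q <= r + t; for r = 0 both P and Q
    vanish. *)
Lemma four_functions2 (a0 a1 b0 b1 c0 c1 d0 d1 : R) :
  0 <= a0 -> 0 <= a1 -> 0 <= b0 -> 0 <= b1 ->
  0 <= c0 -> 0 <= c1 -> 0 <= d0 -> 0 <= d1 ->
  a0 * b0 <= c0 * d0 -> a0 * b1 <= c1 * d0 ->
  a1 * b0 <= c1 * d0 -> a1 * b1 <= c1 * d1 ->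
  (a0 + a1) * (b0 + b1) <= (c0 + c1) * (d0 + d1).
Proof.
move=> ha0 ha1 hb0 hb1 hc0 hc1 hd0 hd1 h00 h01 h10 h11.
set P := a0 * b1; set Q := a1 * b0; set r := c1 * d0; set t := c0 * d1.
suff: P + Q <= r + t by rewrite /P /Q /r /t; nra.
have P0 : 0 <= P by apply: mulr_ge0.
have Q0 : 0 <= Q by apply: mulr_ge0.
have t0 : 0 <= t by apply: mulr_ge0.
have r0 : 0 <= r by apply: mulr_ge0.
have PQ : P * Q <= t * r.
  have -> : P * Q = (a0 * b0) * (a1 * b1) by rewrite /P /Q; ring.
  have -> : t * r = (c0 * d0) * (c1 * d1) by rewrite /t /r; ring.
  by apply: ler_pM => //; apply: mulr_ge0.
have [rp|] := ltrP 0 r; last first.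
  move=> rn; have -> : P = 0 by apply/le_anti; rewrite P0 (le_trans h01).
  have -> : Q = 0 by apply/le_anti; rewrite Q0 (le_trans h10).
  by rewrite addr0 addr_ge0.
rewrite -(ler_pM2l rp).
have : 0 <= (r - P) * (r - Q) by apply: mulr_ge0; rewrite subr_ge0.
nra.
Qed.

(** The Ahlswede-Daykin inequality. Summing out one site preserves the hypothesis, by the one-site
    case. *)
Theorem four_functions r (a b c d : (I -> bool) -> R) :
  (forall w, 0 <= a w) -> (forall w, 0 <= b w) ->
  (forall w, 0 <= c w) -> (forall w, 0 <= d w) ->
  (forall w w', a w * b w' <=
     c (fun i => w i || w' i) * d (fun i => w i && w' i)) ->
  csum r a * csum r b <= csum r c * csum r d.
Proof.
elim: r a b c d => [|i r IH] a b c d a0 b0 c0 d0 H /=.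
  by apply: le_trans (H _ _) _.
apply: IH => [w|w|w|w|w w']; rewrite ?addr_ge0 //.
have E x y := H (update i x w) (update i y w').
apply: four_functions2 => //.
- by move: (E false false); rewrite !update_map2.
- by move: (E false true); rewrite !update_map2.
- by move: (E true false); rewrite !update_map2.
- by move: (E true true); rewrite !update_map2.
Qed.

End OrderedConfigurationSum.

Lemma sum_extend (R : comNzRingType) (I : choiceType) (L : {fset I})
    (g : (I -> bool) -> R) :
  \sum_(s : {ffun L -> bool}) g (extend s) = csum (enum_fset L) g.
Proof.
(* For the induction the list shrinks while [L] stays fixed: only finite functions on [L] that are
   false off [r] are kept. *)
suff H r : uniq r -> {subset r <= enum_fset L} ->
    csum r g = \sum_(s : {ffun L -> bool} | [forall u, s u ==> (val u \in r)])
                 g (extend s).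
  rewrite H ?fset_uniq //; apply: eq_bigl => s; symmetry; apply/forallP => u.
  by apply/implyP => _; exact: (valP u).
elim: r g => [|i r IH] g /=.
  move=> _ _; rewrite (big_pred1 [ffun=> false]).
    congr g; apply/funext => i; rewrite /extend.
    by case: insubP => // u _ _; rewrite ffunE.
  move=> s; apply/forallP/eqP => [H|-> u]; last by rewrite ffunE.
  by apply/ffunP => u; rewrite ffunE; have := H u; case: (s u).
case/andP => ir ur sub.
have iL : i \in L by apply: sub; rewrite mem_head.
pose i0 : L := [` iL]%fset.
pose up (s : {ffun L -> bool}) b := [ffun u => if u == i0 then b else s u].
have upE s b : extend (up s b) = update i b (extend s).
  apply/funext => j; rewrite /extend /update.
  case: insubP => [u uL uj|]; last by move=> jL; case: eqP jL => // ->; rewrite iL.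
  rewrite ffunE -uj; have -> : (u == i0) = (val u == i) by [].
  by case: (val u == i).
rewrite IH //; last by move=> j jr; apply: sub; rewrite inE jr orbT.
rewrite big_split /= [RHS](bigID (fun s : {ffun L -> bool} => s i0)) /= addrC.
congr (_ + _).
  rewrite [RHS](reindex_onto (fun s => up s true) (fun s => up s false)) /=.
    apply: eq_big => [s|s _]; last by rewrite upE.
    rewrite ffunE eqxx andbT; apply/forallP/andP => [H|[/forallP H /eqP E] u].
      have si : s i0 = false.
        by apply/negbTE; apply: contraNN ir => /(implyP (H i0)).
      split; last first.
        by apply/eqP/ffunP => u; rewrite !ffunE; case: eqP => // ->.
      apply/forallP => u; rewrite ffunE inE; case: eqP => [->|_].
        by rewrite eqxx.
      by apply/implyP => /(implyP (H u)) ->; rewrite orbT.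
    apply/implyP => su; have ui : u != i0.
      by apply/eqP => ui; move: su; rewrite -E ffunE ui eqxx.
    have := H u; rewrite ffunE (negbTE ui) su inE => /orP[/eqP uiv|//].
    by case/eqP: ui; apply: val_inj.
  by move=> s /andP[_ si]; apply/ffunP => u; rewrite !ffunE; case: eqP => // ->.
apply: eq_big => [s|s H].
  apply/forallP/andP => [H|[/forallP H si] u].
    split; last by apply: contraNN ir => /(implyP (H i0)).
    by apply/forallP => u; apply/implyP => /(implyP (H u)); rewrite inE orbC => ->.
  apply/implyP => su; have := implyP (H u) su; rewrite inE => /orP[/eqP ui|//].
  by move: si; rewrite -(_ : u = i0) ?su //; apply: val_inj.
congr g; rewrite update_id // /extend; case: insubP => // u _ ui.
by apply: contraNF ir => su; have := implyP (forallP H u) su; rewrite ui.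
Qed.

(** * Boundary correlations of planar Ising graphs *)

Section Plucker.
Variables (R : comNzRingType) (L : nat).
Implicit Types (A B C : {set 'I_L}) (f : {set 'I_L} -> R).

(** Multiplication of spin monomials: the square of a spin is 1, so the index sets add modulo 2. *)
Definition symdiff A B : {set 'I_L} := [set x | (x \in A) (+) (x \in B)]%SET.

(** The Jordan-Wigner sign, from moving a fermion at [a] past the elements of [C] below it. *)
Definition below_sign C (a : 'I_L) : R :=
  \prod_(x < L | (x < a)%N) (-1) ^+ (x \in C).

(* The bilinear relations between the sub-Pfaffians of an antisymmetric matrix. *)
Definition plucker f := forall A B,
  \sum_(a in symdiff A B)
    below_sign (symdiff A B) a * f (symdiff A [set a]%SET) * f (symdiff B [set a]%SET) = 0.

Lemma in_symdiff x A B : (x \in symdiff A B) = (x \in A) (+) (x \in B).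
Proof. by rewrite inE. Qed.

Lemma symdiffC A B : symdiff A B = symdiff B A.
Proof. by apply/finset.setP => x; rewrite !in_symdiff addbC. Qed.

Lemma symdiffA A B C : symdiff A (symdiff B C) = symdiff (symdiff A B) C.
Proof. by apply/finset.setP => x; rewrite !in_symdiff addbA. Qed.

Lemma symdiffK A B : symdiff (symdiff A B) B = A.
Proof. by apply/finset.setP => x; rewrite !in_symdiff addbK. Qed.

Lemma symdiffAC A B C : symdiff (symdiff A B) C = symdiff (symdiff A C) B.
Proof. by rewrite -!symdiffA (symdiffC B). Qed.

Lemma below_sign_symdiff A B a :
  below_sign (symdiff A B) a = below_sign A a * below_sign B a.
Proof.
rewrite /below_sign -big_split; apply: eq_bigr => x _ /=.
by rewrite in_symdiff signr_addb.
Qed.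

Lemma below_signS C (i j : 'I_L) : j = i.+1 :> nat ->
  below_sign C j = (-1) ^+ (i \in C) * below_sign C i.
Proof.
move=> ji; rewrite /below_sign (bigD1 i) /= ?ji //; congr (_ * _).
by apply: eq_bigl => x; rewrite ltnS ltn_neqAle andbC.
Qed.

(** No index lies strictly between the neighbours i and j, so either both or neither are below [a].
    This is where planarity is used. *)
Lemma below_sign_set2 (i j a : 'I_L) : j = i.+1 :> nat -> a != i -> a != j ->
  below_sign [set i; j]%SET a = 1.
Proof.
move=> ji ai aj; have ij : i != j by apply/eqP => e; move: ji; rewrite e; apply: n_Sn.
case: (ltnP i a) => ia.
  have ja : (j < a)%N by rewrite ltn_neqAle eq_sym aj ji.
  rewrite /below_sign (bigD1 i) //= (bigD1 j) /=; last by rewrite ja eq_sym.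
  rewrite !inE !eqxx orbT mulN1r mulN1r opprK big1 // => x.
  by rewrite !inE => /andP[/andP[_ /negbTE ->] /negbTE ->].
rewrite /below_sign big1 // => x xa; rewrite !inE.
have -> : (x == i) = false by apply/negbTE/eqP => e; move: xa; rewrite e ltnNge ia.
have -> // : (x == j) = false.
by apply/negbTE/eqP => e; move: xa; rewrite e ltnNge ji (leq_trans ia).
Qed.

(** The state of independent spins. A nonzero term would force A and B both to be the singleton of
    a, and then a is not in their symmetric difference. *)
Lemma plucker_delta c : plucker (fun A => if A == finset.set0 then c else 0).
Proof.
move=> A B; apply: big1 => a; rewrite in_symdiff => aAB.
case: eqP => [/finset.setP /(_ a)|_]; last by rewrite mulr0 mul0r.
rewrite !inE eqxx; case: eqP => [/finset.setP /(_ a)|_]; last by rewrite mulr0.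
by rewrite !inE eqxx; move: aAB; case: (a \in A); case: (a \in B).
Qed.

(** All terms are multiplied by the same factor: toggling a different from i changes no weight, and
    for a = i exactly one of A, B contains i, so toggling i in both swaps the two weights. *)
Lemma plucker_scale f (i : 'I_L) (c d : R) :
  plucker f -> plucker (fun A => (if i \in A then d else c) * f A).
Proof.
move=> Pf A B; pose g A' := if i \in A' then d else c.
rewrite -[RHS](mulr0 (g A * g B)) -[X in _ = _ * X](Pf A B) mulr_sumr /=.
apply: eq_bigr => a; rewrite in_symdiff => aAB.
suff -> : g A * g B = g (symdiff A [set a]%SET) * g (symdiff B [set a]%SET).
  by rewrite -!/(g _); ring.
rewrite /g !in_symdiff !finset.in_set1; move: aAB; case: (eqVneq i a) => [->|_].
  by case: (a \in A); case: (a \in B) => //= _; rewrite mulrC.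
by rewrite !addbF.
Qed.

(** The coefficients of c c and d d are the relations for A, B and for both sets toggled at i, j.
    The coefficient of c d is the sum of the relations with only one of the two sets toggled, up to
    a discrepancy at i and j, which vanishes. *)
Lemma plucker_adjacent f (i j : 'I_L) (c d : R) : j = i.+1 :> nat ->
  plucker f -> plucker (fun A => c * f A + d * f (symdiff A [set i; j]%SET)).
Proof.
move=> ji Pf A B; set I2 : {set 'I_L} := [set i; j]%SET; set C := symdiff A B.
have ij : i != j by apply/eqP => e; move: ji; rewrite e; apply: n_Sn.
(* The coefficient of c d in the term of index a, without its sign; it takes equal values at i and
   j. *)
pose h a := f (symdiff (symdiff A [set a]%SET) I2) * f (symdiff B [set a]%SET) +
            f (symdiff A [set a]%SET) * f (symdiff (symdiff B [set a]%SET) I2).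
have I2i : symdiff [set i]%SET I2 = [set j]%SET.
  by apply/finset.setP => x; rewrite !inE; case: (eqVneq x i) => // ->; rewrite (negbTE ij).
have I2j : symdiff [set j]%SET I2 = [set i]%SET.
  apply/finset.setP => x; rewrite !inE; case: (eqVneq x j) => [->|]; last by rewrite orbF.
  by rewrite eq_sym (negbTE ij).
have hij : h i = h j.
  by rewrite /h -!symdiffA I2i I2j addrC; congr (_ + _).
have cross : \sum_(a in C) below_sign C a * h a = 0.
  (* The available relations run over [symdiff C I2] instead of [C]. The two index sets and their
     signs differ at i and j only, and the four cases of membership are compared below. *)
  have CI : \sum_(a in symdiff C I2) below_sign (symdiff C I2) a * h a = 0.
    have := Pf A (symdiff B I2); have := Pf (symdiff A I2) B.
    rewrite symdiffA (symdiffAC A I2) -/C => E1 E2.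
    rewrite -[RHS](addr0 0) -[X in _ = X + _]E1 -[X in _ = _ + X]E2 -big_split; apply: eq_bigr => a _ /=.
    rewrite /h (symdiffAC A) (symdiffAC B); ring.
  rewrite -[RHS]CI big_mkcond [RHS]big_mkcond /= (bigD1 i) //= [RHS](bigD1 i) //=.
  rewrite (bigD1 j) 1?eq_sym //= [in RHS](bigD1 j) 1?eq_sym //= !addrA; congr (_ + _); last first.
    apply: eq_bigr => a /andP[ai aj]; rewrite in_symdiff !inE (negbTE ai) (negbTE aj).
    by rewrite addbF below_sign_symdiff (below_sign_set2 ji ai aj) mulr1.
  rewrite !(below_signS _ ji) !in_symdiff !inE !eqxx orbT !addbT -hij.
  have s1 : below_sign I2 i = 1.
    rewrite /below_sign big1 // => x xi; rewrite !inE.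
    have -> : (x == i) = false by apply/negbTE/eqP => e; move: xi; rewrite e ltnn.
    have -> // : (x == j) = false.
    by apply/negbTE/eqP => e; move: xi; rewrite e ltnNge ji leqnSn.
  rewrite below_sign_symdiff s1.
  by case: (_ (+) (i \in B)); case: (_ (+) (j \in B)) => /=; ring.
pose T A' B' := \sum_(a in symdiff A' B') below_sign (symdiff A' B') a *
     f (symdiff A' [set a]%SET) * f (symdiff B' [set a]%SET).
have -> : \sum_(a in C) below_sign C a *
    (c * f (symdiff A [set a]%SET) + d * f (symdiff (symdiff A [set a]%SET) I2)) *
    (c * f (symdiff B [set a]%SET) + d * f (symdiff (symdiff B [set a]%SET) I2)) =
  c * c * T A B + c * d * (\sum_(a in C) below_sign C a * h a)
  + d * d * T (symdiff A I2) (symdiff B I2).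
  rewrite /T symdiffA (symdiffAC A I2) symdiffK -/C.
  rewrite !big_distrr /= -!big_split /=; apply: eq_bigr => a _.
  rewrite /h (symdiffAC A I2) (symdiffAC B I2); ring.
by rewrite /T !Pf cross; ring.
Qed.

Lemma below_sign_imset m (k : 'I_m -> 'I_L) (t : 'I_m) :
  {homo k : x y / (x < y)%N} -> below_sign (k @: [set: _])%SET (k t) = (-1) ^+ t.
Proof.
move=> kinc; have kmono : {mono k : x y / (x < y)%N}.
  move=> x y; case: (ltngtP x y) => [/kinc -> //|/kinc|/val_inj ->]; last by rewrite ltnn.
  by move=> yx; rewrite ltnNge ltnW.
have kinj : injective k.
  move=> x y e; apply/val_inj/eqP; rewrite eqn_leq (leqNgt x) (leqNgt y).
  by rewrite -(kmono y x) -(kmono x y) e ltnn.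
rewrite /below_sign (eq_bigr (fun x => if x \in (k @: [set: _])%SET then -1 else 1)); last first.
  by move=> x _; case: ifP => _.
rewrite -big_mkcondr /= (reindex_omap k (fun x => [pick y | k y == x])) /=; last first.
  move=> x /andP[_ /imsetP[y _ ->]]; case: pickP => [z /eqP /= ->|/(_ y)] //.
  by rewrite eqxx.
rewrite (eq_bigl (fun x : 'I_m => (x < t)%N)); last first.
  move=> x; rewrite kmono imset_f ?inE //= andbT.
  case: pickP => [z /eqP /kinj ->|/(_ x)]; last by rewrite eqxx.
  by rewrite eqxx andbT.
rewrite prodr_const; congr (_ ^+ _).
have E : \sum_(x < m | (x < t)%N) 1%N = t.
  by rewrite -(big_ord_widen m (fun=> 1%N)) ?(ltnW (ltn_ord _)) // sum1_card card_ord.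
by rewrite -[RHS]E sum1_card.
Qed.

(** The relation for the image of k without its first point, and that first point alone: the
    symmetric difference is the whole image, its first element gives the left-hand side, and each
    other element pairs off with the first point. *)
Lemma plucker_expansion f n (k : 'I_n.+2 -> 'I_L) :
  plucker f -> {homo k : x y / (x < y)%N} ->
  f (k @: [set: _])%SET * f finset.set0 =
  \sum_(t < n.+1) (-1) ^+ t * f [set k ord0; k (lift ord0 t)]%SET *
     f ((fun x => k (lift ord0 (lift t x))) @: [set: _])%SET.
Proof.
move=> Pf kinc; have kinj : injective k.
  move=> x y e; apply/val_inj/eqP; rewrite eqn_leq (leqNgt x) (leqNgt y).
  by apply/andP; split; apply/negP => /kinc; rewrite e ltnn.
set A := (k @: [set: _])%SET.
have := Pf (symdiff A [set k ord0]%SET) [set k ord0]%SET.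
rewrite symdiffK (big_imset _ (in2W kinj)) /= (eq_bigl xpredT) => [|x]; last by rewrite inE.
rewrite big_ord_recl.
rewrite (below_sign_imset _ kinc) mul1r symdiffK.
have -> : symdiff [set k ord0] [set k ord0] = finset.set0 by apply/finset.setP=> x; rewrite !inE addbb.
move/eqP; rewrite addr_eq0 => /eqP ->; rewrite -sumrN; apply: eq_bigr => t _.
rewrite (below_sign_imset _ kinc) /= exprS -!mulNr opprK mul1r -!mulrA; congr (_ * _).
rewrite mulrC; congr (f _ * f _); apply/finset.setP => x; rewrite !inE.
  case: (eqVneq x (k ord0)) => [->|]; last by [].
  by rewrite (inj_eq kinj).
apply/idP/imsetP => [|[y _ ->]]; last first.
  rewrite imset_f ?inE // !(inj_eq kinj) (inj_eq lift_inj) eq_sym.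
  by rewrite (negbTE (neq_lift _ _)) eq_sym (negbTE (neq_lift _ _)).
case: imsetP => [[y _ ->]|nA] /=; last first.
  case: (eqVneq x (k ord0)) => [e|_] /=; first by case: nA; exists ord0.
  by move=> /eqP e; case: nA; exists (lift ord0 t).
rewrite !(inj_eq kinj); case: (unliftP ord0 y) => [y' ->|-> //].
rewrite (inj_eq lift_inj); case: (unliftP t y') => [z ->|-> //]; first by exists z.
by rewrite eqxx eq_sym (negbTE (neq_lift _ _)).
Qed.

End Plucker.

Section BoundaryCorrelations.
Variables (R : realType) (I : eqType) (V : seq I) (L : nat).
Hypothesis uV : uniq V.
Implicit Types (W : (I -> bool) -> R) (b : 'I_L -> I) (A : {set 'I_L}).

Lemma spin_sq (x : bool) : spin R x * spin R x = 1.
Proof. by case: x; rewrite /spin ?mulrNN mulr1. Qed.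

Lemma spinN (x : bool) : spin R (~~ x) = - spin R x.
Proof. by case: x; rewrite /spin /= ?opprK. Qed.

(** An unnormalised correlation. The map [b] places the line in the graph; the index set stays fixed
    while [b] moves from row to row, so the Plücker relations always concern functions of the same
    sets. *)
Definition spin_sum W b A : R :=
  csum V (fun s => W s * \prod_(i in A) spin R (s (b i))).

Lemma csum_odd v (g : (I -> bool) -> R) : v \in V ->
  (forall s, g (update v (~~ s v) s) = - g s) -> csum V g = 0.
Proof.
move=> vV gN; have := csum_xor g uV (C := fun i => i == v).
have -> : (fun w : I -> bool => g (fun i => w i (+) (i == v))) = (fun w => -1 * g w).
  apply/funext => w; rewrite mulN1r -gN; congr g; apply/funext => i.
  by rewrite /update; case: eqP => [->|_]; rewrite ?addbT ?addbF.
rewrite csumZ mulN1r => /(_ _) H.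
suff : - csum V g = csum V g by move=> /eqP; rewrite eqNr => /eqP.
by apply: H => i /eqP ->.
Qed.

Lemma spin_sum_adjacent W b (i j : 'I_L) (c d : R) A : i != j ->
  spin_sum (fun s => W s * (c + d * (spin R (s (b i)) * spin R (s (b j))))) b A =
  c * spin_sum W b A + d * spin_sum W b (symdiff A [set i; j]%SET).
Proof.
move=> ij; rewrite /spin_sum -!csumZ -csumD; apply: eq_csum => s.
suff -> : \prod_(x in symdiff A [set i; j]) spin R (s (b x)) =
   (\prod_(x in A) spin R (s (b x))) * (spin R (s (b i)) * spin R (s (b j))) by ring.
have -> : spin R (s (b i)) * spin R (s (b j)) = \prod_(x in [set i; j]%SET) spin R (s (b x)).
  by rewrite big_setU1 ?inE //= big_set1.
rewrite !(big_mkcond (fun x => x \in _)) /= -big_split; apply: eq_bigr => x _ /=.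
rewrite in_symdiff; case: (x \in A); case: (x \in _) => //=; rewrite ?mul1r ?mulr1 //.
by rewrite spin_sq.
Qed.

(** The new vertex v takes over index i from [b i], to which it is joined by an edge. Apart from
    that edge the weight ignores v, so only terms even in its spin survive: the one with d if the
    monomial contains the spin of v, the one with c otherwise. *)
Lemma spin_sum_move W b (i : 'I_L) v (c d : R) A : v \in V -> injective b ->
  (forall x, b x != v) -> (forall s x, W (update v x s) = W s) ->
  spin_sum (fun s => W s * (c + d * (spin R (s (b i)) * spin R (s v))))
    (fun x => if x == i then v else b x) A =
  (if i \in A then d else c) * spin_sum W b A.
Proof.
move=> vV binj bv Wv; rewrite /spin_sum -csumZ; apply/eqP.
have prodv s x (P : pred 'I_L) : \prod_(y | P y) spin R (update v x s (b y)) =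
    \prod_(y | P y) spin R (s (b y)).
  by apply: eq_bigr => y _; rewrite update_other.
have pD s : \prod_(y in A :\ i) spin R (s (if y == i then v else b y)) =
            \prod_(y in A :\ i) spin R (s (b y)).
  by apply: eq_bigr => y; rewrite !inE => /andP[/negbTE ->].
rewrite -subr_eq0 -mulN1r -csumZ -csumD; apply/eqP.
case: ifP => iA.
  rewrite -[RHS](_ : csum V (fun s => c * (W s * spin R (s v) * \prod_(y in A :\ i) spin R (s (b y)))) = 0).
    apply: eq_csum => s; rewrite !(big_setD1 i iA) /= eqxx pD.
    have := spin_sq (s v); move: (spin R (s v)) (spin R (s (b i))) => x y xx.
    have -> : W s * (c + d * (y * x)) = W s * c + W s * d * y * x by ring.
    rewrite mulrDl; set p := \prod_(_ in _) _.
    have -> : W s * d * y * x * (x * p) = W s * d * y * (x * x) * p by ring.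
    rewrite xx; ring.
  apply: (csum_odd vV) => s; rewrite Wv update_same spinN prodv; ring.
rewrite -[RHS](_ : csum V (fun s => d * (W s * spin R (s (b i)) * spin R (s v) * \prod_(y in A) spin R (s (b y)))) = 0).
  apply: eq_csum => s.
  have AD : A :\ i = A by apply/finset.setP => y; rewrite !inE; case: eqP => // ->; rewrite iA.
  have := pD s; rewrite AD => ->; ring.
apply: (csum_odd vV) => s; rewrite Wv update_same spinN prodv update_other //; ring.
Qed.

Lemma spin_sum1 b A : injective b -> (forall i, b i \in V) ->
  spin_sum (fun=> 1) b A = if A == finset.set0 then 2 ^+ size V else 0.
Proof.
move=> binj bV; case: eqP => [->|/eqP/finset.set0Pn[i iA]].
  rewrite /spin_sum -[RHS]mulr1 -csum_const; apply: eq_csum => s.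
  by rewrite finset.big_set0 mulr1.
apply: (csum_odd (bV i)) => s; rewrite !mul1r !(big_setD1 i iA) /=.
rewrite update_same spinN mulNr; congr (- (_ * _)); apply: eq_bigr => y.
by rewrite !inE => /andP[yi _]; rewrite update_other // (inj_eq binj).
Qed.

End BoundaryCorrelations.

(** * Pfaffians *)

Section PermutationPfaffian.
Variable R : realType.

Lemma sum_lift_perm (S : nmodType) m (i0 j0 : 'I_m.+1) (F : 'S_m.+1 -> S) :
  \sum_(s : 'S_m.+1 | s i0 == j0) F s = \sum_(s : 'S_m) F (lift_perm i0 j0 s).
Proof.
(* The default [k] is never taken, since s is injective and [lift i0 k] differs from i0. *)
pose lower (s : 'S_m.+1) (k : 'I_m) := odflt k (unlift (s i0) (s (lift i0 k))).
have lowerE (s : 'S_m.+1) k : lift (s i0) (lower s k) = s (lift i0 k).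
  rewrite /lower; case: unliftP => [x -> //|/perm_inj e].
  by have := neq_lift i0 k; rewrite e eqxx.
have lower_inj (s : 'S_m.+1) : injective (lower s).
  move=> x y e; apply: (@lift_inj _ i0); apply: (@perm_inj _ s).
  by rewrite -!lowerE e.
rewrite (reindex_onto (lift_perm i0 j0) (fun s => perm (@lower_inj s))) /=.
  apply: eq_bigl => s; rewrite lift_perm_id eqxx /=; apply/eqP/permP => k.
  rewrite permE; apply: (@lift_inj _ j0).
  by have := lowerE (lift_perm i0 j0 s) k; rewrite lift_perm_id lift_perm_lift.
move=> s /eqP sij; apply/permP => k; case: (unliftP i0 k) => [k' ->|->].
  by rewrite lift_perm_lift permE -sij lowerE.
by rewrite lift_perm_id.
Qed.

Section FirstRow.
Variables (n : nat) (A : 'M[R]_(n.+1.*2)).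
Hypothesis A_anti : forall i j, A i j = - A j i.

Let ev (i : 'I_n.+1) : 'I_(n.+1.*2) := Ordinal (double_lt i).
Let od (i : 'I_n.+1) : 'I_(n.+1.*2) := Ordinal (doubleS_lt i).
Let H (s : 'S_(n.+1.*2)) := (-1) ^+ s * \prod_(i < n.+1) A (s (ev i)) (s (od i)) : R.

Let ev_inj : injective ev.
Proof. by move=> i j /(congr1 val) /= /double_inj /val_inj. Qed.

Let od_inj : injective od.
Proof. by move=> i j /(congr1 val) /= [] /double_inj /val_inj. Qed.

Let ev_od i j : (ev i == od j) = false.
Proof.
by apply/negbTE/eqP => /(congr1 (odd \o val)) /=; rewrite !odd_double.
Qed.

Let od_ev i j : (od i == ev j) = false.
Proof. by rewrite eq_sym ev_od. Qed.

(** Exchanging the two positions of a pair changes both the sign of the permutation and, by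
    antisymmetry, that of one entry. *)
Let H_swap k s : H (tperm (ev k) (od k) * s)%g = H s.
Proof.
rewrite /H odd_permM odd_tperm ev_od /= (bigD1 k) //= [in RHS](bigD1 k) //=.
rewrite !permM tpermL tpermR A_anti signrN mulNr mulrA mulrN mulNr opprK -mulrA.
congr (_ * (_ * _)); apply: eq_bigr => i ik; rewrite !permM.
have ki : k != i by rewrite eq_sym.
have -> : tperm (ev k) (od k) (ev i) = ev i by rewrite tpermD ?od_ev ?(inj_eq ev_inj).
by have -> : tperm (ev k) (od k) (od i) = od i by rewrite tpermD ?ev_od ?(inj_eq od_inj).
Qed.

(** Exchanging two whole pairs of positions is an even permutation and only permutes the factors. *)
Let H_exchange i s :
  H (tperm (ev ord0) (ev i) * (tperm (od ord0) (od i) * s))%g = H s.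
Proof.
rewrite /H !odd_permM !odd_tperm (inj_eq ev_inj) (inj_eq od_inj) addKb; congr (_ * _).
rewrite [RHS](reindex_inj (@perm_inj _ (tperm ord0 i))); apply: eq_bigr => k _ /=.
have ev_t : tperm (od ord0) (od i) (tperm (ev ord0) (ev i) (ev k)) = ev (tperm ord0 i k).
  case: (tpermP ord0 i k) => [->|->|/eqP k0 /eqP ki].
  - by rewrite tpermL tpermD // od_ev.
  - by rewrite tpermR tpermD // od_ev.
  - by rewrite !tpermD ?od_ev // (inj_eq ev_inj) eq_sym.
have od_t : tperm (od ord0) (od i) (tperm (ev ord0) (ev i) (od k)) = od (tperm ord0 i k).
  rewrite (tpermD (z := od k)) ?ev_od //.
  case: (tpermP ord0 i k) => [->|->|/eqP k0 /eqP ki].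
  - by rewrite tpermL.
  - by rewrite tpermR.
  - by rewrite !tpermD // (inj_eq od_inj) eq_sym.
by rewrite !permM ev_t od_t.
Qed.

(** The two symmetries of [H] bring any position to the first one, so the value 0 contributes
    equally wherever it occurs. *)
Let H_position p :
  \sum_(s : 'S_(n.+1.*2) | s p == ev ord0) H s =
  \sum_(s : 'S_(n.+1.*2) | s (ev ord0) == ev ord0) H s.
Proof.
suff [u up uH] : exists2 u : 'S_(n.+1.*2), u (ev ord0) = p & forall s, H (u * s)%g = H s.
  rewrite [RHS](reindex_inj (mulgI u)); apply: eq_big => s; last by rewrite uH.
  by rewrite permM up.
have pn : ((val p)./2 < n.+1)%N by rewrite ltn_half_double; exact: ltn_ord.
pose i := Ordinal pn; case: (boolP (odd p)) => podd.
  exists (tperm (ev ord0) (od ord0) * (tperm (ev ord0) (ev i) * tperm (od ord0) (od i)))%g.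
    rewrite !permM tpermL (tpermD (z := od ord0)) ?ev_od // tpermL.
    by apply: val_inj; rewrite /= -[RHS](odd_double_half p) podd.
  by move=> s; rewrite -!mulgA H_swap H_exchange.
exists (tperm (ev ord0) (ev i) * tperm (od ord0) (od i))%g.
  rewrite !permM tpermL tpermD ?od_ev //.
  by apply: val_inj; rewrite /= -[RHS](odd_double_half p) (negbTE podd).
by move=> s; rewrite -mulgA H_exchange.
Qed.

(** Fixing the value 0 at the first position costs a factor 2(n+1), which turns the normalisation
    for n+1 into the one for n. If t determines the value at the second position, removing both
    positions leaves a permutation whose sign differs by (-1)^t. *)
Lemma pfaffian_first_row :
  pfaffian A = \sum_(t < n.*2.+1) (-1) ^+ t * A (ord0 : 'I_(n.*2.+2)) (lift ord0 t) *
    pfaffian (\matrix_(i, j) A (lift ord0 (lift t i)) (lift ord0 (lift t j)) : 'M[R]_(n.*2)).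
Proof.
have -> : pfaffian A = (2 ^+ n.+1 * n.+1`!%:R)^-1 * \sum_s H s by [].
have -> : \sum_s H s = n.+1.*2%:R * \sum_(s : 'S_(n.+1.*2) | s (ev ord0) == ev ord0) H s.
  rewrite (partition_big (fun s : 'S_(n.+1.*2) => (s^-1)%g (ev ord0)) xpredT) //=.
  rewrite (eq_bigr (fun=> \sum_(s : 'S_(n.+1.*2) | s (ev ord0) == ev ord0) H s)).
    by rewrite sumr_const card_ord mulr_natl.
  move=> p _; rewrite -(H_position p); apply: eq_bigl => s.
  by apply/eqP/eqP => [<-|<-]; rewrite ?permKV ?permK.
have ev0 : ev ord0 = ord0 :> 'I_(n.*2.+2) by apply: val_inj.
have -> : \sum_(s : 'S_(n.+1.*2) | s (ev ord0) == ev ord0) H s =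
   \sum_(t < n.*2.+1) \sum_(s : 'S_(n.*2))
     H (lift_perm (ord0 : 'I_(n.*2.+2)) ord0 (lift_perm ord0 t s)).
  rewrite ev0 (@sum_lift_perm _ n.*2.+1 ord0 ord0 H).
  rewrite (partition_big (fun s : 'S_(n.*2.+1) => s ord0) xpredT) //=.
  apply: eq_bigr => t _.
  exact: (@sum_lift_perm _ n.*2 ord0 t (fun s => H (lift_perm ord0 ord0 s))).
rewrite mulrA mulr_sumr; apply: eq_bigr => t _.
rewrite /pfaffian mulrCA.
have -> : (2 ^+ n.+1 * n.+1`!%:R)^-1 * n.+1.*2%:R = (2 ^+ n * n`!%:R)^-1 :> R.
  rewrite factS natrM -muln2 natrM exprS.
  have f0 : n`!%:R != 0 :> R by rewrite pnatr_eq0 -lt0n fact_gt0.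
  have n0 : 1 + n%:R != 0 :> R by rewrite nat1r pnatr_eq0.
  have p0 : (2 : R) ^+ n != 0 by rewrite expf_neq0.
  by field; rewrite f0 p0 n0.
congr (_ * _); rewrite mulr_sumr; apply: eq_bigr => s _.
rewrite /H !odd_lift_perm /=.
have -> : (-1) ^+ (odd t (+) s) = (-1) ^+ t * (-1) ^+ s :> R by rewrite signr_addb signr_odd.
rewrite (@big_ord_recl _ _ _ n) -!mulrA; congr (_ * _).
have od0 : od ord0 = lift ord0 ord0 :> 'I_(n.*2.+2) by apply: val_inj.
rewrite ev0 od0 lift_perm_id lift_perm_lift lift_perm_id mulrCA; congr (_ * (_ * _)).
apply: eq_bigr => i _; rewrite mxE.
have -> : ev (lift ord0 i) = lift ord0 (lift ord0 (Ordinal (double_lt i))) :> 'I_(n.*2.+2).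
  by apply: val_inj.
have -> : od (lift ord0 i) = lift ord0 (lift ord0 (Ordinal (doubleS_lt i))) :> 'I_(n.*2.+2).
  by apply: val_inj.
by rewrite !lift_perm_lift.
Qed.

End FirstRow.

Lemma pfaffian0 (A : 'M[R]_(0.*2)) : pfaffian A = 1.
Proof.
rewrite /pfaffian fact0 expr0 mul1r invr1 mul1r (big_pred1 (1%g : 'S_0)) => [|s].
  by rewrite odd_perm1 expr0 big_ord0 mulr1.
by apply/esym/eqP/permP => -[].
Qed.

Lemma pfaffianZ n (c : R) (A : 'M[R]_(n.*2)) : pfaffian (c *: A) = c ^+ n * pfaffian A.
Proof.
rewrite /pfaffian mulrCA; congr (_ * _); rewrite mulr_sumr; apply: eq_bigr => s _.
rewrite mulrCA; congr (_ * _); have -> : c ^+ n = \prod_(i < n) c by rewrite prodr_const card_ord.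
rewrite -big_split /=.
by apply: eq_bigr => i _; rewrite mxE.
Qed.

End PermutationPfaffian.

Lemma homo_lift2 m (t : 'I_m.+1) :
  {homo (fun x : 'I_m => lift ord0 (lift t x)) : x y / (x < y)%N}.
Proof. by move=> x y xy /=; rewrite /bump; case: leqP; case: leqP => /=; lia. Qed.

(* Only the values g i j with i < j are used. *)
Definition antisym_mx (R : realType) m (g : 'I_m -> 'I_m -> R) : 'M[R]_m :=
  \matrix_(i, j) (if i == j then 0 else if (i < j)%N then g i j else - g j i).

Lemma antisym_mxN (R : realType) m (g : 'I_m -> 'I_m -> R) i j :
  antisym_mx g i j = - antisym_mx g j i.
Proof.
rewrite !mxE; case: (eqVneq i j) => [_|ij]; first by rewrite oppr0.
case: ltngtP => [_|_|/val_inj e]; rewrite ?opprK //.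
by rewrite e eqxx in ij.
Qed.

(** By induction on n: [plucker_expansion], divided by the square of f at the empty set, is the
    expansion of the Pfaffian along its first row. *)
Lemma plucker_pfaffian (R : realType) L (f : {set 'I_L} -> R) :
  plucker f -> f finset.set0 != 0 ->
  forall n (k : 'I_(n.*2) -> 'I_L), {homo k : x y / (x < y)%N} ->
  f (k @: [set: _])%SET / f finset.set0 =
  pfaffian (antisym_mx (fun i j => f [set k i; k j]%SET / f finset.set0)).
Proof.
move=> Pf f0; elim=> [|n IH] k kinc.
  rewrite pfaffian0 -[RHS](divff f0); congr (f _ / _); apply/finset.setP => x.
  by rewrite inE; apply/imsetP => -[[]].
rewrite pfaffian_first_row; last exact: antisym_mxN.
apply: (canLR (mulfK f0)); apply: (mulIf f0).
rewrite (@plucker_expansion _ _ f n.*2 k Pf kinc) !mulr_suml.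
apply: eq_bigr => t _; set k' := fun x => k (lift ord0 (lift t x)).
have k'inc : {homo k' : x y / (x < y)%N} by move=> x y xy; apply/kinc/homo_lift2.
have mono i j : (lift ord0 (lift t i) < lift ord0 (lift t j))%N = (i < j)%N.
  case: (ltngtP i j) => [/(homo_lift2 t) -> //|/(homo_lift2 t) ji|/val_inj ->].
    by rewrite ltnNge ltnW.
  by rewrite ltnn.
set M := \matrix_(i, j) _.
have -> : M = antisym_mx (fun i j => f [set k' i; k' j]%SET / f finset.set0).
  by apply/matrixP => i j; rewrite !mxE !(inj_eq lift_inj) mono.
by rewrite -(IH _ k'inc) mxE /=; field.
Qed.

(** * Pair partitions, their signs, and the recursion on the partner of the first point *)

Section PairPartitions.
Variable n : nat.
Implicit Types (w : {set {set 'I_(n.*2)}}) (p q : 'I_(n.*2) * 'I_(n.*2)).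

Lemma pair_partitionP w :
  reflect [/\ forall B, B \in w -> #|B| = 2%N,
              forall x, exists2 B : {set 'I_(n.*2)}, B \in w & x \in B &
              forall B C x, B \in w -> C \in w -> x \in B -> x \in C -> B = C]
          (w \in @pair_partitions n).
Proof.
rewrite inE; apply: (iffP andP) => [[/and3P[/eqP cw tw _] /forall_inP c2]|[c2 cw tw]].
  split=> [B /c2/eqP //|x|B C x Bw Cw xB xC].
    by have /finset.bigcupP[B Bw xB] : x \in finset.cover w; [rewrite cw inE|exists B].
  by rewrite -(finset.def_pblock tw Bw xB) (finset.def_pblock tw Cw xC).
split; last by apply/forall_inP => B /c2 ->.
apply/and3P; split.
- apply/eqP/finset.setP => x; rewrite inE; apply/finset.bigcupP.
  by have [B Bw xB] := cw x; exists B.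
- apply/finset.trivIsetP => B C Bw Cw BC; rewrite -finset.setI_eq0; apply/finset.set0Pn => -[x].
  by rewrite inE => /andP[xB xC]; case/eqP: BC; apply: (tw B C x).
- by apply/negP => /c2; rewrite finset.cards0.
Qed.

Lemma is_pair_inj w p q : is_pair w p -> is_pair w q ->
  [set p.1; p.2]%SET = [set q.1; q.2]%SET -> p = q.
Proof.
case: p q => [a b] [c d] /andP[/= ab _] /andP[/= cd _] /finset.setP E.
have := E a; have := E b; have := E c; have := E d; rewrite !inE !eqxx ?orbT /=.
move=> /orP[]/eqP ? /orP[]/eqP ? /esym/orP[]/eqP ? /esym/orP[]/eqP ?; subst => //;
  by move: ab cd; rewrite ?ltnn //; lia.
Qed.

(** Each block is represented by exactly one ordered pair and the blocks cover every point once.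
    This turns a crossing sign into a product over points. *)
Lemma prod_pairs (T : comNzRingType) w (g : 'I_(n.*2) -> T) :
  w \in @pair_partitions n ->
  \prod_(p | is_pair w p) (g p.1 * g p.2) = \prod_x g x.
Proof.
move=> wP; have [c2 cw tw] := pair_partitionP w wP.
have -> : \prod_x g x = \prod_(B in w) \prod_(x in B) g x.
  rewrite -finset.big_trivIset /=.
    by apply: eq_bigl => x; apply/esym/finset.bigcupP; have [B Bw xB] := cw x; exists B.
  apply/finset.trivIsetP => B C Bw Cw BC; rewrite -finset.setI_eq0; apply/finset.set0Pn => -[x].
  by rewrite inE => /andP[xB xC]; case/eqP: BC; apply: (tw B C x).
have wE : w = [set [set p.1; p.2]%SET | p in [set p | is_pair w p]%SET]%SET.
  apply/finset.setP => B; apply/idP/finset.imsetP => [Bw|[p]]; last first.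
    by rewrite inE => /andP[_ pw] ->.
  have /eqP/finset.cards2P[x [y [xy BE]]] := c2 _ Bw.
  case: (ltngtP x y) => [lt|lt|/val_inj e]; last by rewrite e eqxx in xy.
    by exists (x, y) => //; rewrite inE /is_pair /= lt -BE.
  exists (y, x); last by rewrite BE finset.setUC.
  by rewrite inE /is_pair /= lt finset.setUC -BE.
rewrite [in RHS]wE big_imset /=; last first.
  by move=> p q; rewrite !inE => pw qw; apply: (is_pair_inj pw qw).
rewrite [RHS](eq_bigl (is_pair w)) => [|p]; last by rewrite inE.

apply: eq_bigr => p /andP[lt _]; rewrite finset.big_setU1 ?finset.big_set1 //= inE.
by apply/eqP => e; rewrite e ltnn in lt.
Qed.

End PairPartitions.

Section AddPair.
Variables (n : nat) (t : 'I_(n.*2.+1)).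
Implicit Types (w : {set {set 'I_(n.*2)}}) (v : {set {set 'I_(n.*2.+2)}}).

(** The increasing relabelling of the points outside [first_pair]. With it, pair partitions
    containing that block correspond to pair partitions of two points fewer. *)
Definition skip2 (x : 'I_(n.*2)) : 'I_(n.*2.+2) := lift ord0 (lift t x).
Arguments skip2 : simpl never.
Definition first_pair : {set 'I_(n.*2.+2)} := [set ord0; lift ord0 t]%SET.
Definition add_pair w : {set {set 'I_(n.*2.+2)}} :=
  (first_pair |: [set (skip2 @: B)%SET | B : {set 'I_(n.*2)} in w])%SET.
Definition remove_pair v : {set {set 'I_(n.*2)}} :=
  [set (skip2 @^-1: B)%SET | B : {set 'I_(n.*2.+2)} in (v :\ first_pair)%SET]%SET.

Lemma skip2_inj : injective skip2.
Proof. by move=> x y /lift_inj /lift_inj. Qed.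

Lemma skip2_mono x y : (skip2 x < skip2 y)%N = (x < y)%N.
Proof.
case: (ltngtP x y) => [/(homo_lift2 t) -> //|/(homo_lift2 t) ji|/val_inj ->].
  by rewrite ltnNge ltnW.
by rewrite ltnn.
Qed.

Lemma skip2_first x : skip2 x \notin first_pair.
Proof. by rewrite !inE /skip2 (inj_eq lift_inj) eq_sym (negbTE (neq_lift _ _)) eq_sym (negbTE (neq_lift _ _)). Qed.

Lemma skip2P x : x \notin first_pair -> exists y, x = skip2 y.
Proof.
rewrite !inE negb_or; case: (unliftP ord0 x) => [y ->|->]; last by rewrite eqxx.
case/andP => _; rewrite (inj_eq lift_inj).
by case: (unliftP t y) => [z ->|->]; [exists z|rewrite eqxx].
Qed.

Lemma card_first_pair : #|first_pair| = 2%N.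
Proof. by rewrite finset.cards2 neq_lift. Qed.

Lemma first_pair_notin w : first_pair \notin [set (skip2 @: B)%SET | B : {set 'I_(n.*2)} in w]%SET.
Proof.
apply/finset.imsetP => -[B _ /finset.setP /(_ ord0)]; rewrite !inE eqxx /= => /esym/finset.imsetP[x _].
by move=> e; have := skip2_first x; rewrite -e !inE eqxx.
Qed.

Lemma add_pairK : cancel add_pair remove_pair.
Proof.
move=> w; rewrite /remove_pair /add_pair finset.setU1K ?first_pair_notin //.
rewrite -finset.imset_comp -[RHS](finset.imset_id w); apply: eq_in_imset => B _ /=.
by apply/finset.setP => x; rewrite !inE finset.mem_imset //; apply: skip2_inj.
Qed.

Lemma add_pair_partition w :
  w \in @pair_partitions n -> add_pair w \in @pair_partitions n.+1.
Proof.
case/pair_partitionP => c2 cw tw.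
have first (B : {set 'I_(n.*2)}) x : x \in first_pair -> x \notin (skip2 @: B)%SET.
  by move=> xf; apply/finset.imsetP => -[y _ e]; move: (skip2_first y); rewrite -e xf.
apply/pair_partitionP; split.
- move=> B; rewrite finset.in_setU1 => /orP[/eqP ->|/finset.imsetP[C Cw ->]].
    exact: card_first_pair.
  by rewrite finset.card_imset ?c2 //; apply: skip2_inj.
- move=> x; case: (boolP (x \in first_pair)) => [xf|/skip2P[y ->]].
    by exists first_pair => //; rewrite finset.setU11.
  have [B Bw yB] := cw y; exists (skip2 @: B)%SET; last by rewrite finset.imset_f.
  by rewrite finset.in_setU1 orbC finset.imset_f.
- move=> B C x; rewrite !finset.in_setU1.
  move=> /orP[/eqP ->|/finset.imsetP[B' B'w ->]] /orP[/eqP ->|/finset.imsetP[C' C'w ->]] //.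
  + by move=> /(first C') /negbTE ->.
  + by move=> xB /(first B'); rewrite xB.
  + case/finset.imsetP => y yB -> /finset.imsetP[z zC /skip2_inj e].
    by rewrite (tw B' C' y) // e.
Qed.

Lemma remove_pairK v : v \in @pair_partitions n.+1 -> first_pair \in v ->
  add_pair (remove_pair v) = v.
Proof.
case/pair_partitionP => c2 cw tw fv; rewrite /add_pair /remove_pair -finset.imset_comp.
rewrite -[RHS](finset.setD1K fv); congr (_ |: _)%SET; rewrite -[RHS](finset.imset_id (v :\ _)).
apply: eq_in_imset => B; rewrite finset.in_setD1 => /andP[Bf Bv] /=.
apply/finset.setP => x; apply/finset.imsetP/idP => [[y]|xB]; first by rewrite inE => yB ->.
have xf : x \notin first_pair by apply: contra Bf => xf; rewrite (tw B first_pair x).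
by have [y e] := skip2P xf; exists y; rewrite // inE -e.
Qed.

Lemma remove_pair_partition v : v \in @pair_partitions n.+1 -> first_pair \in v ->
  remove_pair v \in @pair_partitions n.
Proof.
move=> vP fv; have vK := remove_pairK vP fv.
have [c2 cw tw] := @pair_partitionP n.+1 v vP.
have im B : B \in remove_pair v -> (skip2 @: B)%SET \in v.
  by move=> Bw; rewrite -vK finset.in_setU1 orbC finset.imset_f.
apply/pair_partitionP; split.
- by move=> B /im /c2; rewrite finset.card_imset //; apply: skip2_inj.
- move=> x; have [B] := cw (skip2 x); rewrite -{1}vK finset.in_setU1 => /orP[/eqP ->|].
    by rewrite (negbTE (skip2_first x)).
  by case/finset.imsetP => C Cw ->; rewrite finset.mem_imset; [exists C|apply: skip2_inj].
- move=> B C x Bw Cw xB xC; apply: (imset_inj skip2_inj).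
  by apply: (tw _ _ (skip2 x)); rewrite ?im ?finset.imset_f.
Qed.

Lemma prod_add_pair (T : comNzRingType) w (F : 'I_(n.*2.+2) * 'I_(n.*2.+2) -> T) :
  \prod_(p | @is_pair n.+1 (add_pair w) p) F p =
  F (ord0, lift ord0 t) * \prod_(q | is_pair w q) F (skip2 q.1, skip2 q.2).
Proof.
have imE (a b : 'I_(n.*2)) : [set skip2 a; skip2 b]%SET = (skip2 @: [set a; b])%SET.
  by rewrite finset.imsetU !finset.imset_set1.
rewrite (bigD1 (ord0, lift ord0 t)) /=; last first.
  by apply/andP; split=> //; exact: finset.setU11.
congr (_ * _); pose h q := (skip2 q.1, skip2 q.2).
have h_inj : injective h.
  move=> [a b] [c d] e; congr (_, _); apply: skip2_inj.
    exact: (congr1 fst e).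
  exact: (congr1 snd e).
have E : \prod_(q | is_pair w q) F (h q) = \prod_(p in h @: [set q | is_pair w q]%SET) F p.
  rewrite big_imset /=; last by move=> q q' _ _ /h_inj.
  by apply: eq_bigl => q; rewrite inE.
rewrite E; apply: eq_bigl => -[a b]; apply/idP/finset.imsetP => [|[[c d]]].
  rewrite /is_pair /= finset.in_setU1 => /andP[/andP[ab /orP[/eqP abE|/finset.imsetP[B Bw abE]]] ne].
    case/eqP: ne; have a0 : a \in first_pair by rewrite -abE !inE eqxx.
    have b0 : b \in first_pair by rewrite -abE !inE eqxx orbT.
    move: a0 b0 ab; rewrite !inE => /orP[]/eqP -> /orP[]/eqP -> //; by rewrite ?ltnn.
  have : a \in [set a; b]%SET by rewrite !inE eqxx.
  have : b \in [set a; b]%SET by rewrite !inE eqxx orbT.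
  rewrite abE => /finset.imsetP[d _ bd] /finset.imsetP[c _ ac]; exists (c, d); last by rewrite /h ac bd.
  rewrite inE /is_pair /= -skip2_mono -ac -bd ab.
  by have /(imset_inj skip2_inj) <- // : (skip2 @: B = skip2 @: [set c; d])%SET by rewrite -imE -ac -bd.
rewrite inE /is_pair /= => /andP[cd cdw] [-> ->]; rewrite skip2_mono cd /=.
rewrite finset.in_setU1 imE finset.imset_f ?orbT //=; by apply/eqP => -[/(congr1 val)].
Qed.

Lemma skip2_sg x y :
  Num.sg (Posz (skip2 x) - Posz (skip2 y)) = Num.sg (Posz x - Posz y).
Proof.
case: (ltngtP x y) => [xy|yx|/val_inj ->]; last by rewrite !subrr.
  have sxy : (skip2 x < skip2 y)%N by rewrite skip2_mono.
  by rewrite !ltr0_sg // subr_lt0 ltz_nat.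
have sxy : (skip2 y < skip2 x)%N by rewrite skip2_mono.
by rewrite !gtr0_sg // subr_gt0 ltz_nat.
Qed.

Lemma sg_prod (J : finType) (P : pred J) (F : J -> int) :
  Num.sg (\prod_(j | P j) F j) = \prod_(j | P j) Num.sg (F j).
Proof. by apply: big_morph; [exact: sgrM|exact: sgr1]. Qed.

(** The two factors with 0 have product of sign +1. The point t+1 contributes +1 against the t
    remaining points below it and -1 against the 2n - t points above it, in total (-1)^t. *)
Lemma sign_first w : w \in @pair_partitions n ->
  \prod_(q | is_pair w q)
    Num.sg ((0 - Posz (skip2 q.1)) * (0 - Posz (skip2 q.2)) *
     (Posz (lift ord0 t) - Posz (skip2 q.1)) * (Posz (lift ord0 t) - Posz (skip2 q.2)))
  = (-1) ^+ t.
Proof.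
move=> wP; pose g (x : 'I_(n.*2)) : int := if (x < t)%N then 1 else -1.
have gE x : Num.sg (Posz (lift ord0 t) - Posz (skip2 x)) = g x.
  rewrite /g /skip2 /= /bump !leq0n; case: ltnP => xt.
    by rewrite gtr0_sg //; lia.
  by rewrite ltr0_sg //; lia.
transitivity (\prod_x g x).
  rewrite -(prod_pairs _ wP); apply: eq_bigr => q _.
  by rewrite !sgrM !gE !sub0r !sgrN !gtr0_sg ?mulrNN ?mul1r // /skip2 /=.
have -> : (-1) ^+ t = \prod_(x < n.*2) (if (x < t)%N then -1 else 1 : int).
  rewrite -big_mkcond /= -(big_ord_widen n.*2 (fun=> -1)) ?prodr_const ?card_ord //.
  by rewrite -ltnS.
have s1 : \prod_(x < n.*2) (-1 : int) = 1.
  by rewrite prodr_const card_ord -signr_odd odd_double.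
rewrite -[RHS]mul1r -[X in _ = X * _]s1 -big_split; apply: eq_bigr => x _ /=.
by rewrite /g; case: ifP.
Qed.

(** The block of 0 comes before all others in the order by smallest element, so its factors split
    off as [sign_first]; the relabelling keeps the signs of all other differences. *)
Lemma pp_sgn_add_pair w : w \in @pair_partitions n ->
  @pp_sgn n.+1 (add_pair w) = (-1) ^+ t * pp_sgn w.
Proof.
move=> wP; rewrite /pp_sgn prod_add_pair sgrM /=; congr (_ * _).
  rewrite big_mkcondr prod_add_pair /= mul1r sg_prod -[RHS](sign_first wP).
  by apply: eq_bigr => q _.
rewrite !sg_prod; apply: eq_bigr => p _.
rewrite big_mkcondr prod_add_pair /= mul1r [in RHS]big_mkcondr !sg_prod.
apply: eq_bigr => q _ /=; rewrite skip2_mono; case: ifP => // _.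
by rewrite !sgrM !skip2_sg.
Qed.

End AddPair.

(** Arbitrary entries instead of Cauchy ones, so that the induction on n can pass to a submatrix. *)
Definition pair_sum (R : realType) n (g : 'I_(n.*2) -> 'I_(n.*2) -> R) : R :=
  \sum_(w in @pair_partitions n)
    (pp_sgn w)%:~R * \prod_(p | is_pair w p) g p.1 p.2.

Section PairSum.
Variable R : realType.

Lemma pair_sum_first_row n (g : 'I_(n.*2.+2) -> 'I_(n.*2.+2) -> R) :
  @pair_sum R n.+1 g = \sum_(t < n.*2.+1) (-1) ^+ t * g ord0 (lift ord0 t) *
    @pair_sum R n (fun x y => g (skip2 t x) (skip2 t y)).
Proof.
(* The point paired with 0, up to the shift by one. The default is never taken on a pair partition,
   where 0 lies in some block. *)
pose partner (v : {set {set 'I_(n.*2.+2)}}) : 'I_(n.*2.+1) :=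
  odflt ord0 [pick t | first_pair t \in v].
have partnerP v t : v \in @pair_partitions n.+1 -> (partner v == t) = (first_pair t \in v).
  move=> vP; have [c2 cw tw] := @pair_partitionP n.+1 v vP.
  have uniq2 t1 t2 : first_pair t1 \in v -> first_pair t2 \in v -> t1 = t2.
    move=> v1 v2; have /finset.setP/(_ (lift ord0 t1)) : first_pair t1 = first_pair t2.
      by apply: (tw _ _ ord0); rewrite // !inE eqxx.
    by rewrite !inE eqxx orbT (inj_eq lift_inj) => /esym/eqP.
  rewrite /partner; case: pickP => [t' t'v|none] /=.
    by apply/eqP/idP => [<-//|tv]; apply: uniq2.
  have [B Bv B0] := cw ord0; have /eqP/finset.cards2P[x [y [xy BE]]] := c2 _ Bv.
  have [z zE] : exists z, B = first_pair z.
    move: B0 xy; rewrite BE !inE => /orP[]/eqP <-.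
      by case: (unliftP ord0 y) => [z ->|-> /eqP//]; exists z.
    by case: (unliftP ord0 x) => [z ->|-> /eqP//]; exists z; rewrite finset.setUC.
  by have := none z; rewrite -zE Bv.
rewrite /pair_sum (partition_big partner xpredT) //=; apply: eq_bigr => t _.
rewrite (eq_bigl (fun v => v \in [set add_pair t w | w in @pair_partitions n]%SET)); last first.
  move=> v; apply/andP/finset.imsetP => [[vP]|[w wP ->]].
    rewrite partnerP // => tv; exists (remove_pair t v).
      exact: remove_pair_partition.
    by rewrite remove_pairK.
  have vP := add_pair_partition t wP; split=> //.
  by rewrite partnerP // finset.setU11.
rewrite big_imset /=; last by move=> w w' _ _; apply: (can_inj (@add_pairK n t)).
rewrite mulr_sumr; apply: eq_bigr => w wP.
rewrite pp_sgn_add_pair // prod_add_pair /= rmorphM rmorphXn rmorphN rmorph1 -!mulrA.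
by congr (_ * _); rewrite mulrCA.
Qed.

Lemma pair_sum0 (g : 'I_(0.*2) -> 'I_(0.*2) -> R) : @pair_sum R 0 g = 1.
Proof.
rewrite /pair_sum (big_pred1 finset.set0) => [|w].
  rewrite /pp_sgn !big1 ?sgr1 ?mulr1 //; by case=> -[].
apply/pair_partitionP/eqP => [[c2 _ _]|->].
  apply/finset.setP => B; rewrite inE; apply/negP => /c2.
  by rewrite (_ : B = finset.set0) ?finset.cards0 //; apply/finset.setP => -[].
by split=> [B|[]|B C]; rewrite ?inE.
Qed.

(** Both sides satisfy the same expansion along the first row; no counting of the 2^n n!
    permutations behind each pair partition is required. *)
Lemma pfaffian_pair_sum n (g : 'I_(n.*2) -> 'I_(n.*2) -> R) :
  pfaffian (antisym_mx g) = pair_sum g.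
Proof.
elim: n g => [|n IH] g; first by rewrite pfaffian0 pair_sum0.
rewrite pfaffian_first_row; last exact: antisym_mxN.
rewrite pair_sum_first_row; apply: eq_bigr => t _; rewrite mxE /= -IH.
congr (_ * pfaffian _); apply/matrixP => i j.
by rewrite !mxE (inj_eq (@skip2_inj n t)) (@skip2_mono n t).
Qed.

End PairSum.

(** * The Ising model on a box *)

Lemma mem_box N (k : int) (j : nat) :
  ((k, j) \in box N) = [&& - Posz N <= k, k <= Posz N & (j <= N)%N].
Proof.
apply/imfset2P/idP => [[i]|/and3P[kl ku jN]].
  by rewrite mem_iota => /andP[_ iN] [j']; rewrite mem_iota => /andP[_ j'N] [-> ->]; lia.
exists (absz (k + Posz N)); first by rewrite mem_iota; lia.
by exists j; [rewrite mem_iota; lia | congr (_, _); lia].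
Qed.

Lemma mem_edges (L : {fset vertex}) (e : edge) :
  (e \in edges L) = (src e \in L) && (tgt e \in L).
Proof.
by case: e => v b; rewrite !inE /src /=; case: b; rewrite andbT.
Qed.

Section BoxProducts.
Variables (T : comNzRingType) (N : nat).

Definition column (i : nat) : int := Posz i - Posz N.

Lemma column_inj : injective column.
Proof. by move=> i i'; rewrite /column; lia. Qed.

Lemma edges_box_perm :
  perm_eq (enum_fset (edges (box N)))
    ([seq ((column i, j), false) | j <- iota 0 N.+1, i <- iota 0 N.*2] ++
     [seq ((column i, j), true) | j <- iota 0 N, i <- iota 0 N.*2.+1]).
Proof.
have uq (b : bool) m p :
    uniq [seq ((column i, j), b) | j <- iota 0 m, i <- iota 0 p].
  apply: allpairs_uniq; rewrite ?iota_uniq // => -[j i] [j' i'] _ _ /=.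
  by case=> /column_inj -> ->.
apply: uniq_perm; first exact: fset_uniq.
  rewrite cat_uniq !uq andbT; apply/hasPn => e /allpairsPdep[j [i [_ _ ->]]].
  by apply/negP => /allpairsPdep[j' [i' [_ _ []]]].
move=> e; rewrite mem_cat; have -> : (e \in enum_fset (edges (box N))) = (e \in edges (box N)) by [].
rewrite mem_edges; case: e => [[k j] b]; move: k j b => k j b.
have -> : (src (k, j, b) \in box N) && (tgt (k, j, b) \in box N) =
  ((k : int, j : nat) \in box N) && ((if b then (k, j.+1) else (k + 1, j)) \in box N) by [].
move: (k : int) (j : nat) => {}k {}j.
apply/idP/orP => [|[/allpairsPdep[j' [i' [+ + [-> -> ->]]]]|/allpairsPdep[j' [i' [+ + [-> -> ->]]]]]].
- case: b => /andP[]; [move=> H1 H2; right|move=> H1 H2; left]; apply/allpairsPdep;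
    exists j, (absz (k + Posz N)); rewrite !mem_iota; move: H1 H2;
    rewrite /= !mem_box => H1 H2;
    (split; [lia|lia|congr ((_, _), _); rewrite /column; lia]).
- by rewrite !mem_iota !mem_box /column; lia.
- by rewrite !mem_iota !mem_box /column; lia.
Qed.

(** The edges in the order in which the box is built: horizontal and vertical ones, row by row. *)
Lemma prod_edges_box (phi : edge -> T) :
  \prod_(e <- enum_fset (edges (box N))) phi e =
  (\prod_(0 <= j < N.+1) \prod_(0 <= i < N.*2) phi ((column i, j), false)) *
  (\prod_(0 <= j < N) \prod_(0 <= i < N.*2.+1) phi ((column i, j), true)).
Proof.
rewrite (perm_big _ edges_box_perm) big_cat !big_allpairs_dep /index_iota !subn0.
by [].
Qed.

End BoxProducts.

Section IsingBox.
Variables (R : realType) (N : nat).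

Let L := N.*2.+1.
Let V := enum_fset (box N).

Definition ising_cosh : R := (expR (beta_c R) + expR (- beta_c R)) / 2.
Definition ising_sinh : R := (expR (beta_c R) - expR (- beta_c R)) / 2.

Definition edge_factor (s : vertex -> bool) (e : edge) : R :=
  ising_cosh + ising_sinh * (spin R (s (src e)) * spin R (s (tgt e))).

(** A product u of two spins is 1 or -1, so exp(b u) = cosh b + u sinh b. *)
Lemma ising_weight_prod (B : {fset vertex}) (s : vertex -> bool) :
  ising_weight R B s = \prod_(e <- enum_fset (edges B)) edge_factor s e.
Proof.
rewrite /ising_weight mulr_sumr expR_sum big_seq_fsetE.
apply: eq_bigr => e _; rewrite /edge_factor /ising_cosh /ising_sinh /spin.
by case: (s (src _)); case: (s (tgt _)); rewrite ?mulrNN ?mulr1 ?mul1r ?mulrN1 ?mulN1r ?mulrN ?mulr1; field.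
Qed.

Definition row (j : nat) (i : 'I_L) : vertex := (column N i, j).

Let uV : uniq V. Proof. exact: fset_uniq. Qed.

Let row_in i j : (j <= N)%N -> row j i \in V.
Proof.
move=> jN; rewrite /V /row -[_ \in _]/(_ \in box N) mem_box /column jN.
have := ltn_ord i; rewrite /L; lia.
Qed.

Lemma plucker_horizontal W j m : (m <= N.*2)%N ->
  plucker (spin_sum V W (row j)) ->
  plucker (spin_sum V (fun s => W s * \prod_(0 <= i < m) edge_factor s ((column N i, j), false)) (row j)).
Proof.
move=> + PW; elim: m => [|m IH] mN.
  congr plucker: PW; congr spin_sum; apply/funext => s.
  by rewrite big_geq // mulr1.
have m1L : (m.+1 < L)%N by rewrite /L ltnS.
pose i0 : 'I_L := Ordinal (ltnW m1L); pose i1 : 'I_L := Ordinal m1L.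
have i01 : i0 != i1 by rewrite -val_eqE /= ltn_eqF.
have := plucker_adjacent ising_cosh ising_sinh (erefl : i1 = i0.+1 :> nat) (IH (ltnW mN)).
congr plucker; apply/funext => A; rewrite -spin_sum_adjacent //.
congr spin_sum; apply/funext => s; rewrite big_nat_recr //= [RHS]mulrA; congr (_ * _).
have ti : tgt ((column N m, j), false) = row j i1.
  by rewrite /tgt /row /column /=; congr (_, _); lia.
by rewrite /edge_factor ti.
Qed.

(** The line descends one vertex at a time: after m edges its first m points lie in row j and the
    others still in row j+1. As [W] ignores row j, each new vertex is fresh, as [spin_sum_move]
    demands. *)
Lemma plucker_vertical W j m : (m <= L)%N -> (j < N)%N ->
  (forall i s x, W (update (row j i) x s) = W s) ->
  plucker (spin_sum V W (row j.+1)) ->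
  plucker (spin_sum V (fun s => W s * \prod_(0 <= i < m) edge_factor s ((column N i, j), true))
    (fun i => if (i < m)%N then row j i else row j.+1 i)).
Proof.
move=> + jN Wj PW; elim: m => [|m IH] mL.
  congr plucker: PW; congr spin_sum; apply/funext => s.
  by rewrite big_geq // mulr1.
pose i0 : 'I_L := Ordinal mL.
have := plucker_scale i0 ising_cosh ising_sinh (IH (ltnW mL)).
congr plucker; apply/funext => A.
have E := @spin_sum_move R _ V L uV _ _ i0 (row j i0) ising_cosh ising_sinh A.
rewrite -E; last first.
- move=> s x; rewrite Wj; congr (_ * _); apply: eq_big_nat => i /andP[_ im].
  have ne : column N i != column N m by rewrite (inj_eq (@column_inj _)) ltn_eqF.
  by rewrite /edge_factor !update_other // xpair_eqE (negbTE ne).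
- move=> x; case: ifP => xm; rewrite /row xpair_eqE.
    by rewrite (inj_eq (@column_inj _)) ltn_eqF.
  by rewrite andbC gtn_eqF.
- move=> x y; case: ifP => _; case: ifP => _ [] /column_inj /val_inj //.
- by apply: row_in; exact: ltnW.
rewrite /spin_sum; apply: eq_csum => s; rewrite big_nat_recr //= [W s * (_ * _)]mulrA.
congr (_ * _ * _).
  by rewrite ltnn /edge_factor [X in _ + _ * X]mulrC.
apply: eq_bigr => x _; case: (eqVneq x i0) => [->|xi]; first by rewrite /= ltnSn.
by rewrite [(x < m.+1)%N]ltnS [(x <= m)%N]leq_eqVlt -[(x == m :> nat)]/(x == i0) (negbTE xi).
Qed.

(** The weight contains the edges at height j and above only. The sum still runs over the whole box,
    the rows below being free spins, and the induction descends from the top row, where no edge is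
    present at the start. *)
Lemma plucker_rows j : (j <= N)%N ->
  plucker (spin_sum V (fun s =>
     (\prod_(j <= j' < N.+1) \prod_(0 <= i < N.*2) edge_factor s ((column N i, j'), false)) *
     (\prod_(j <= j' < N) \prod_(0 <= i < N.*2.+1) edge_factor s ((column N i, j'), true)))
     (row j)).
Proof.
move=> jN; rewrite -(subKn jN); move: (N - j)%N (leq_subr j N) => k {j jN}.
elim: k => [|k IH] kN.
  rewrite subn0.
  have P1 : plucker (spin_sum V (fun=> 1 : R) (row N)).
    have := @plucker_delta R L (2 ^+ size V).
    congr plucker; apply/funext => A; rewrite spin_sum1 //.
      by move=> x y [] /column_inj /val_inj.
    by move=> i; apply: row_in.
  have := plucker_horizontal (leqnn _) P1; congr plucker; congr spin_sum.
  by apply/funext => s; rewrite big_nat1 mul1r [X in _ * X]big_geq // mulr1.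
have kN' := ltnW kN; set j := (N - k.+1)%N.
have jE : (N - k)%N = j.+1 by rewrite /j; lia.
have jN : (j < N)%N by rewrite /j; lia.
have := IH kN'; rewrite jE; set W := (X in spin_sum _ X _) => PW.
have H : plucker (spin_sum V (fun s => W s *
    \prod_(0 <= i < L) edge_factor s ((column N i, j), true)) (row j)).
  have -> : row j = (fun i : 'I_L => if (i < L)%N then row j i else row j.+1 i).
    by apply/funext => i; rewrite ltn_ord.
  apply: plucker_vertical => // i s x.
  have ne (c : int) (y : nat) : (j < y)%N -> (c, y) != row j i.
    by move=> jy; rewrite xpair_eqE negb_and orbC gtn_eqF.
  rewrite /W; congr (_ * _); apply: eq_big_nat => j' /andP[jj' _];
    apply: eq_bigr => i' _; rewrite /edge_factor /src /tgt /= !update_other ?ne //.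
  exact: ltnW.
have := plucker_horizontal (leqnn _) H; congr plucker; congr spin_sum.
apply/funext => s; rewrite /W -/j [in RHS]big_ltn 1?ltnW //.
rewrite [X in _ = _ * X]big_ltn //; rewrite /L; ring.
Qed.

Lemma plucker_ising_box : plucker (spin_sum V (ising_weight R (box N)) (row 0)).
Proof.
have := plucker_rows (leq0n N); congr plucker; congr spin_sum; apply/funext => s.
by rewrite ising_weight_prod prod_edges_box.
Qed.

End IsingBox.

(** * Random clusters, the Edwards-Sokal coupling and domination *)

Section ConfigurationSumReordering.
Variables (R : comNzRingType) (I : eqType).
Implicit Types (r : seq I) (g h : (I -> bool) -> R).

Lemma update_comm (i j : I) b c (w : I -> bool) : i != j ->
  update i b (update j c w) = update j c (update i b w).
Proof.
move=> ij; apply/funext => x; rewrite /update.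
by case: (eqVneq x i) => // ->; rewrite (negbTE ij).
Qed.

(** The recursion follows the order of the list, so invariance needs proof: updates at distinct
    sites commute, and any site can be moved to the front. *)
Lemma csum_perm r r' g : uniq r -> perm_eq r r' -> csum r g = csum r' g.
Proof.
have move_front r1 i r2 h : i \notin r1 -> csum (r1 ++ i :: r2) h = csum (i :: r1 ++ r2) h.
  elim: r1 h => [//|j r1 IH] h; rewrite inE negb_or => /andP[ij ir1] /=.
  rewrite IH //=; apply: eq_csum => w.
  by rewrite !(update_comm _ _ _ ij) addrACA.
elim: r r' g => [|i r IH] r' g; first by rewrite perm_sym => _ /perm_nilP ->.
move=> /= /andP[ir ur] p; have ir' : i \in r' by rewrite -(perm_mem p) mem_head.
case/path.splitPr: r' / ir' p => r1 r2 p.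
have ur' : uniq (r1 ++ i :: r2) by rewrite -(perm_uniq p) /= ir.
have ir1 : i \notin r1.
  by move: ur'; rewrite cat_uniq => /and3P[_ /hasPn /(_ i (mem_head _ _))].
rewrite move_front //=; apply: IH => //.
by rewrite -(perm_cons i) (perm_trans p) // perm_sym -cat1s perm_catCA.
Qed.

Lemma csum_single r h : uniq r ->
  (forall (w : I -> bool) i, i \in r -> w i -> h w = 0) -> csum r h = h (fun=> false).
Proof.
elim: r h => [//|i r IH] h /= /andP[ir ur] h0.
rewrite IH //=; last first.
  move=> w j jr wj.
  have ji : j != i by apply: contraNneq ir => <-.
  rewrite !(h0 _ j) ?addr0 // ?inE ?jr ?orbT //; by rewrite update_other.
rewrite [h (update i true _)](h0 _ i) ?mem_head ?update_same // addr0.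
by congr h; apply: update_id.
Qed.

Lemma csum_closed r1 r2 g : uniq (r1 ++ r2) ->
  csum (r1 ++ r2) (fun w => if all (fun i => ~~ w i) r2 then g w else 0) = csum r1 g.
Proof.
rewrite cat_uniq => /and3P[_ /hasPn dj u2]; rewrite csum_cat csum_single //.
  apply: eq_csum_supp => w wr1; case: allP => [_|[]].
    by congr g; apply/funext => i; case: ifP => // ir; case: (w i) (wr1 i) => // /(_ isT); rewrite ir.
  by move=> i ir2; rewrite (negbTE (dj _ ir2)).
move=> w2 i ir2 w2i; rewrite -[RHS](csum0 R r1); apply: eq_csum => w1.
case: allP => // /(_ i ir2); by rewrite (negbTE (dj _ ir2)) w2i.
Qed.

End ConfigurationSumReordering.

Lemma ler_csum_supp (R : realFieldType) (I : eqType) (r : seq I) (g h : (I -> bool) -> R) :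
  (forall w : I -> bool, (forall i, w i -> i \in r) -> g w <= h w) -> csum r g <= csum r h.
Proof.
elim: r g h => [|i r IH] g h gh /=; first exact: gh.
by apply: IH => w wr; apply: lerD; apply: gh => j; rewrite /update inE;
  case: eqP => //= _ /wr.
Qed.

Section RandomCluster.
Variable R : realType.
Implicit Types (V : seq vertex) (E : seq edge) (w : edge -> bool) (s : vertex -> bool).

Definition agree s (e : edge) : bool := s (src e) == s (tgt e).

Definition compatible E w s : bool := all (fun e => w e ==> agree s e) E.

(** This is 2 to the number of clusters, a compatible configuration being a choice of one spin per
    cluster. Counting spin configurations replaces graph theory by linear algebra modulo 2. *)
Definition cluster_count V E w : R := csum V (fun s => (compatible E w s)%:R).

Definition open_weight E w : R := \prod_(e <- E) (if w e then p_c R else 1 - p_c R).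

Definition rc_weight V E w : R := open_weight E w * cluster_count V E w.

(** The edge factor of the Edwards-Sokal joint weight: summed over spins it gives the random-cluster
    weight, summed over edge states the Ising weight up to a constant. *)
Definition es_factor s (e : edge) (b : bool) : R :=
  if b then p_c R * (agree s e)%:R else 1 - p_c R.

Lemma sqrt2_gt0 : 0 < Num.sqrt 2 :> R.
Proof. by rewrite sqrtr_gt0. Qed.

Lemma p_c_gt0 : 0 < p_c R.
Proof. by rewrite /p_c divr_gt0 ?addr_gt0 ?sqrt2_gt0. Qed.

Lemma one_minus_p_c : 1 - p_c R = (1 + Num.sqrt 2)^-1.
Proof.
rewrite /p_c; have := sqrt2_gt0; set q := Num.sqrt _ => q0.
by field; rewrite gt_eqF // addr_gt0.
Qed.

Lemma one_minus_p_c_gt0 : 0 < 1 - p_c R.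
Proof. by rewrite one_minus_p_c invr_gt0 addr_gt0 ?sqrt2_gt0. Qed.

Lemma prod_es_factor E w s :
  \prod_(e <- E) es_factor s e (w e) = open_weight E w * (compatible E w s)%:R.
Proof.
rewrite /open_weight /compatible; elim: E => [|e E IH]; first by rewrite !big_nil mulr1.
rewrite !big_cons IH /= /es_factor; case: (w e) => //=; last by rewrite mulrA.
by case: (agree s e) => /=; ring.
Qed.

Lemma rc_weightE V E w :
  rc_weight V E w = csum V (fun s => \prod_(e <- E) es_factor s e (w e)).
Proof.
by rewrite /rc_weight /cluster_count -csumZ; apply: eq_csum => s; rewrite prod_es_factor.
Qed.

(* e^{-2 beta_c} = 1 - p_c, the Edwards-Sokal relation between the two models *)
Lemma edge_factor_es s e :
  es_factor s e false + es_factor s e true = expR (- beta_c R) * edge_factor R s e.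
Proof.
have q0 : 0 < 1 + Num.sqrt 2 :> R by rewrite addr_gt0 ?sqrt2_gt0.
have e1 : expR (beta_c R) * expR (- beta_c R) = 1 by rewrite -expRD subrr expR0.
have e2 : expR (- beta_c R) * expR (- beta_c R) = 1 - p_c R.
  rewrite -expRD -opprD /beta_c -splitr expRN lnK ?one_minus_p_c //.
rewrite /es_factor /edge_factor /ising_cosh /ising_sinh /agree.
set x := expR (beta_c R) in e1 *; set y := expR (- beta_c R) in e1 e2 *.
rewrite /spin -e2; have -> : p_c R = 1 - y * y by rewrite e2; ring.
case: (s (src e)); case: (s (tgt e)) => /=; try by field.
- by transitivity (x * y); [rewrite e1; ring|field].
- by transitivity (x * y); [rewrite e1; ring|field].
Qed.

(** Given the spins, the edges are independent and are summed one by one. A constant h gives the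
    partition functions, a product of two spins the correlations. *)
Lemma csum_rc_weight V E (h : (vertex -> bool) -> R) : uniq E ->
  csum E (fun w => csum V (fun s => h s * \prod_(e <- E) es_factor s e (w e))) =
  expR (- beta_c R) ^+ size E * csum V (fun s => h s * \prod_(e <- E) edge_factor R s e).
Proof.
move=> uE; rewrite csum_exchange -csumZ; apply: eq_csum => s; rewrite csumZ csum_prod //.
rewrite (eq_bigr _ (fun e _ => edge_factor_es s e)).
rewrite big_split /= mulrCA; congr (_ * _).
by rewrite big_const_seq count_predT -Monoid.iteropE.
Qed.

(* Spin configurations form a group under pointwise addition: for fixed u, the s with s
   compatible with a and s + u compatible with b are empty or a coset of the subgroup
   compatible with a and b, and then u is compatible with their intersection. *)
Lemma cluster_count_supermodular V E a b : uniq V ->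
  cluster_count V E a * cluster_count V E b <=
  cluster_count V E (fun e => a e || b e) * cluster_count V E (fun e => a e && b e).
Proof.
move=> uV; have xorP w s t : compatible E w s -> compatible E w t ->
    compatible E w (fun v => s v (+) t v).
  move=> /allP cs /allP ct; apply/allP => e eE.
  have := cs e eE; have := ct e eE; rewrite /agree; case: (w e) => //=.
  by move=> /eqP -> /eqP ->.
have orP s : compatible E (fun e => a e || b e) s = compatible E a s && compatible E b s.
  rewrite /compatible -all_predI; apply: eq_all => e /=.
  by case: (a e); case: (b e); rewrite //= ?andbb ?andbT.
have -> : cluster_count V E a * cluster_count V E b =
    csum V (fun u => csum V (fun s => (compatible E a s && compatible E b (fun v => u v (+) s v))%:R)).
  rewrite -[RHS]csum_exchange /cluster_count -csumZr; apply: eq_csum_supp => s sV.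
  rewrite -[X in _ * X = _](csum_xor _ uV sV) -csumZ; apply: eq_csum => u.
  by rewrite -natrM mulnb.
rewrite mulrC -csumZr; apply: ler_csum_supp => u uVs.
case: (pselect (exists s, [/\ forall v, s v -> v \in V, compatible E a s &
     compatible E b (fun v => u v (+) s v)])) => [[s [sV sa sb]]|none]; last first.
  rewrite [X in X <= _](_ : _ = 0).
    by rewrite mulr_ge0 ?ler0n // csum_ge0 // => s; rewrite ler0n.
  rewrite -[RHS](csum0 R V); apply: eq_csum_supp => s sV.
  by case: andP => // -[sa sb]; case: none; exists s.
have -> : compatible E (fun e => a e && b e) u.
  have -> : u = (fun v => s v (+) (u v (+) s v)).
    by apply/funext => v; rewrite addbC addbK.
  apply: xorP; apply/allP => e eE; apply/implyP => /andP[ae be].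
    exact: (implyP (allP sa e eE)).
  exact: (implyP (allP sb e eE)).
rewrite mul1r -(csum_xor _ uV sV) /cluster_count; apply: ler_csum => t.
rewrite ler_nat orP; case: (boolP (_ && _)) => // /andP[ta tb].
have -> : compatible E a t.
  have := xorP _ _ _ ta sa; congr compatible; apply/funext => v; exact: addbK.
have -> // : compatible E b t.
have := xorP _ _ _ tb sb; congr compatible; apply/funext => v.
by case: (u v); case: (t v); case: (s v).
Qed.

(** The FKG lattice condition: the product of edge weights is modular, so everything comes from the
    cluster counts. *)
Lemma rc_weight_supermodular V E a b : uniq V ->
  rc_weight V E a * rc_weight V E b <=
  rc_weight V E (fun e => a e || b e) * rc_weight V E (fun e => a e && b e).
Proof.
move=> uV; rewrite /rc_weight mulrACA [X in _ <= X]mulrACA.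
have -> : open_weight E a * open_weight E b =
  open_weight E (fun e => a e || b e) * open_weight E (fun e => a e && b e).
  rewrite /open_weight -!big_split; apply: eq_bigr => e _ /=.
  by case: (a e); case: (b e) => //=; rewrite mulrC.
apply: ler_wpM2l; last exact: cluster_count_supermodular.
by apply: mulr_ge0; apply: prodr_ge0 => e _; case: ifP => _;
  rewrite ltW ?p_c_gt0 ?one_minus_p_c_gt0.
Qed.

Definition connected_in E w (x y : vertex) : Prop :=
  connected_event x y (fun e => w e && (e \in E)).

Lemma open_adjacentP w (u v : vertex) :
  reflect (exists e, w e /\ ((src e = u /\ tgt e = v) \/ (src e = v /\ tgt e = u)))
    (open_adjacent w u v).
Proof.
apply: (iffP existsP) => [[b /orP[]/andP[/eqP t we]]|[[e b] [we [[s t]|[s t]]]]].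
- by exists (u, b); split=> //; left.
- by exists (v, b); split=> //; right.
- by exists b; rewrite -s -t /src /= eqxx we.
- by exists b; rewrite -s -t /src /= eqxx we orbT.
Qed.

Lemma open_adjacent_sym w : symmetric (open_adjacent w).
Proof.
by move=> u v; apply: eq_existsb => b; rewrite orbC.
Qed.

Lemma sub_open_adjacent w w' : (forall e, w e -> w' e) ->
  subrel (open_adjacent w) (open_adjacent w').
Proof.
move=> ww' u v /open_adjacentP[e [we H]]; apply/open_adjacentP.
by exists e; split; first exact: ww'.
Qed.

Lemma connected_event_mono (x y : vertex) w w' : (forall e, w e -> w' e) ->
  connected_event x y w -> connected_event x y w'.
Proof.
by move=> ww' [p [pw lp]]; exists p; split=> //; apply: sub_path pw; apply: sub_open_adjacent.
Qed.

Lemma compatible_path E w s x p : compatible E w s ->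
  path (open_adjacent (fun e => w e && (e \in E))) x p -> s (last x p) = s x.
Proof.
move=> /allP cs; elim: p x => [//|y p IH] x /= /andP[/open_adjacentP[e [/andP[we eE] H]] /IH ->].
by have /eqP := implyP (cs e eE) we; case: H => -[<- <-].
Qed.

(** Compatible spins agree along an open path, so their product is 1 if x and y are connected.
    Otherwise flipping the cluster of x preserves compatibility and reverses the sign of the
    product, and the sum vanishes. *)
Lemma csum_two_spins V E w x y : uniq V -> x \in V -> y \in V ->
  (forall e, e \in E -> src e \in V /\ tgt e \in V) ->
  csum V (fun s => spin R (s x) * spin R (s y) * \prod_(e <- E) es_factor s e (w e)) =
  rc_weight V E w * `[< connected_in E w x y >]%:R.
Proof.
move=> uV xV yV EV; rewrite rc_weightE -csumZr.
case: asboolP => [[p [pw lp]]|nc].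
  apply: eq_csum => s; rewrite prod_es_factor mulr1.
  case: (boolP (compatible E w s)) => [cs|]; last by rewrite !mulr0.
  by rewrite -lp (compatible_path cs pw) spin_sq mul1r.
pose C v := (v \in V) && `[< connected_in E w x v >].
have step e : e \in E -> w e -> C (src e) = C (tgt e).
  move=> eE we; have [sV tV] := EV e eE; rewrite /C sV tV /=.
  have ext u v : open_adjacent (fun e => w e && (e \in E)) u v ->
      connected_in E w x u -> connected_in E w x v.
    move=> uv [p [pw lp]]; exists (rcons p v); rewrite rcons_path pw lp last_rcons.
    by split.
  by apply/asboolP/asboolP; apply: ext; apply/open_adjacentP; exists e;
    rewrite we eE; split=> //; [left|right].
rewrite [RHS](_ : _ = 0); last first.
  by rewrite -[RHS](csum0 R V); apply: eq_csum => s; rewrite mulr0.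
set g := (X in csum V X); have CV i : C i -> i \in V by case/andP.
have := csum_xor g uV CV.
have -> : (fun s => g (fun i => s i (+) C i)) = (fun s => -1 * g s).
  apply/funext => s; rewrite /g !prod_es_factor.
  have -> : compatible E w (fun i => s i (+) C i) = compatible E w s.
    apply: eq_in_all => e eE; case we : (w e) => //=.
    rewrite /agree (step e eE we); case: (C _); last by rewrite !addbF.
    by rewrite !addbT (inj_eq negb_inj).
  have -> : C x = true by rewrite /C xV /=; apply/asboolP; exists [::].
  have -> : C y = false by rewrite /C yV /=; apply/asboolP.
  by rewrite addbT addbF spinN; ring.
by rewrite csumZ mulN1r => /eqP; rewrite eqNr => /eqP.
Qed.

End RandomCluster.

(** A function constant on components is determined by its values at the roots, which are
    arbitrary. *)
Lemma card_invariant_configs (T : finType) (e : rel T) : connect_sym e ->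
  #|[pred s : {ffun T -> bool} | [forall u, forall v, e u v ==> (s u == s v)]]| =
  (2 ^ n_comp e predT)%N.
Proof.
move=> symE; have <- : #|pffun_on false (roots e) predT| = (2 ^ n_comp e predT)%N.
  rewrite card_pffun_on card_bool; congr (2 ^ _)%N.
  by apply: eq_card => x; rewrite !inE andbT.
pose f (s : {ffun T -> bool}) := [ffun x => roots e x && s x].
have inv_root (s : {ffun T -> bool}) x :
    [forall u, forall v, e u v ==> (s u == s v)] -> s (fingraph.root e x) = s x.
  move=> /forallP inv; have /connectP[p pe ->] := connect_root e x.
  elim: p x pe => [//|y p IH] x /= /andP[xy /IH ->].
  by apply/esym/eqP/(implyP (forallP (inv x) y)).
rewrite -(card_in_imset (f := f)); last first.
  move=> s t; rewrite !inE => si ti /ffunP st; apply/ffunP => x.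
  rewrite -(inv_root s) // -(inv_root t) //; have := st (fingraph.root e x).
  by rewrite !ffunE (roots_root symE).
rewrite -[RHS](cardsE (pffun_on false (roots e) predT)); apply: eq_card => t; rewrite finset.in_set.
apply/imsetP/pffun_onP => [[s _ ->]|[/supportP t0 _]].
  split=> [|y _] //; apply/supportP => x; rewrite ffunE.
  by rewrite -topredE /= => /negbTE ->.
exists [ffun x => t (fingraph.root e x)].
  rewrite inE; apply/forallP => u; apply/forallP => v; apply/implyP => uv.
  by rewrite !ffunE; apply/eqP; congr (t _); apply/(fingraph.rootP symE); exact: connect1.
apply/ffunP => x; rewrite !ffunE; case: (boolP (roots e x)) => [/eqP -> //|nx].
by rewrite t0.
Qed.

Section GibbsMean.
Variables (R : realType) (I : choiceType).

Definition gibbs_mean (L : {fset I}) (weight : (I -> bool) -> R) (g : (I -> bool) -> R) : R :=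
  csum (enum_fset L) (fun w => weight w * g w) / csum (enum_fset L) weight.

Lemma gibbsE (L : {fset I}) (weight : (I -> bool) -> R) A :
  gibbs L weight A = gibbs_mean L weight (\1_A).
Proof. by rewrite /gibbs /gibbs_mean -!sum_extend. Qed.

End GibbsMean.

(** * Finite volume: Edwards-Sokal identity and comparison of two boxes *)

Section FiniteVolume.
Variable R : realType.
Implicit Types (L : {fset vertex}) (w : edge -> bool).

Lemma extend_val (I : choiceType) (L : {fset I}) (s : {ffun L -> bool}) (u : L) :
  extend s (val u) = s u.
Proof. by rewrite /extend valK. Qed.

Lemma fk_weight_rc L w :
  fk_weight R L w = rc_weight R (enum_fset L) (enum_fset (edges L)) w.
Proof.
rewrite /fk_weight /rc_weight; congr (_ * _).
  rewrite /open_weight big_seq_fsetE /= (bigID (fun e : edges L => w (val e))) /=.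
  congr (_ * _); rewrite -prodr_const; apply: eq_big => e //; rewrite inE.
    by move=> ->.
  by move=> /negbTE ->.
rewrite /cluster_count -sum_extend -natrX -card_invariant_configs; last first.
  by apply: sym_connect_sym => u v /=; rewrite open_adjacent_sym.
rewrite -sum1_card natr_sum big_mkcond /=; apply: eq_bigr => s _.
rewrite inE; set a := [forall u, _]; suff -> : compatible (enum_fset (edges L)) w (extend s) = a.
  by case: a.
apply/allP/forallP => [H u|H e eE].
  apply/forallP => v; apply/implyP => /open_adjacentP[e [we uv]].
  have eE : e \in enum_fset (edges L).
    rewrite -[_ \in _]/(e \in edges L) mem_edges.
    by case: uv => -[-> ->]; rewrite !fsvalP.
  have := implyP (H e eE) we; rewrite /agree.
  by case: uv => -[-> ->]; rewrite !extend_val // eq_sym.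
move: eE; rewrite -[_ \in _]/(e \in edges L) mem_edges => /andP[sL tL].
apply/implyP => we; have := forallP (H [` sL]%fset) [` tL]%fset => /implyP.
rewrite /agree -!extend_val /=; apply.
by apply/open_adjacentP; exists e; split=> //; left.
Qed.

Definition two_spin (x y : vertex) (s : vertex -> bool) : R := spin R (s x) * spin R (s y).

Definition connect_indicator L (x y : vertex) w : R :=
  `[< connected_in (enum_fset (edges L)) w x y >]%:R.

Let edges_in L e : e \in enum_fset (edges L) ->
  src e \in enum_fset L /\ tgt e \in enum_fset L.
Proof. by rewrite -[_ \in _]/(e \in edges L) mem_edges => /andP[]. Qed.

Lemma csum_fk_connect L x y : x \in L -> y \in L ->
  csum (enum_fset (edges L)) (fun w => fk_weight R L w * connect_indicator L x y w) =
  expR (- beta_c R) ^+ size (enum_fset (edges L)) *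
  csum (enum_fset L) (fun s => ising_weight R L s * two_spin x y s).
Proof.
move=> xL yL; have := csum_rc_weight (enum_fset L) (two_spin x y) (fset_uniq (edges L)).
under [in RHS]eq_csum do rewrite -ising_weight_prod mulrC.
move=> <-; apply: eq_csum => w; rewrite fk_weight_rc csum_two_spins ?fset_uniq //.
exact: edges_in.
Qed.

Lemma csum_fk L :
  csum (enum_fset (edges L)) (fk_weight R L) =
  expR (- beta_c R) ^+ size (enum_fset (edges L)) * csum (enum_fset L) (ising_weight R L).
Proof.
have := csum_rc_weight (enum_fset L) (fun=> 1 : R) (fset_uniq (edges L)).
under [in RHS]eq_csum do rewrite -ising_weight_prod mul1r.
move=> <-; apply: eq_csum => w; rewrite fk_weight_rc rc_weightE; apply: eq_csum => s.
by rewrite mul1r.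
Qed.

Theorem edwards_sokal L x y : x \in L -> y \in L ->
  gibbs_mean (edges L) (fk_weight R L) (connect_indicator L x y) =
  gibbs_mean L (ising_weight R L) (two_spin x y).
Proof.
move=> xL yL; rewrite /gibbs_mean csum_fk_connect // csum_fk.
have k0 : expR (- beta_c R) ^+ size (enum_fset (edges L)) != 0 by rewrite expf_neq0 ?gt_eqF ?expR_gt0.
by rewrite -mulf_div divff // mul1r.
Qed.

Lemma ising_weight_gt0 L s : 0 < ising_weight R L s.
Proof. exact: expR_gt0. Qed.

Lemma csum_ising_gt0 L : 0 < csum (enum_fset L) (ising_weight R L).
Proof. by apply: csum_gt0 => s; exact: ising_weight_gt0. Qed.

Lemma csum_fk_gt0 L : 0 < csum (enum_fset (edges L)) (fk_weight R L).
Proof. by rewrite csum_fk mulr_gt0 ?exprn_gt0 ?expR_gt0 ?csum_ising_gt0. Qed.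

Lemma fk_weight_ge0 L w : 0 <= fk_weight R L w.
Proof.
by rewrite /fk_weight !mulr_ge0 ?exprn_ge0 // ltW ?p_c_gt0 ?one_minus_p_c_gt0.
Qed.

Lemma connect_indicator_ge0 L x y w : 0 <= connect_indicator L x y w.
Proof. exact: ler0n. Qed.

Lemma connect_indicator_mono L x y w w' : (forall e, w e -> w' e) ->
  connect_indicator L x y w <= connect_indicator L x y w'.
Proof.
move=> ww'; rewrite /connect_indicator ler_nat; case: asboolP => // c.
case: asboolP => // -[]; apply: connected_event_mono c => e /andP[we eE].
by rewrite ww'.
Qed.

Lemma connect_indicator_sub L L' x y w : {subset edges L <= edges L'} ->
  connect_indicator L x y w <= connect_indicator L' x y w.
Proof.
move=> LL'; rewrite /connect_indicator ler_nat; case: asboolP => // c.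
case: asboolP => // -[]; apply: connected_event_mono c => e /andP[we eE].
by rewrite we; apply: LL'.
Qed.

Section Domination.
Variables (L L' : {fset vertex}) (x y : vertex).
Hypotheses (LL' : {subset L <= L'}) (xL : x \in L) (yL : y \in L).

Let V := enum_fset L.
Let V' := enum_fset L'.
Let E := enum_fset (edges L).
Let E' := enum_fset (edges L').
Let outV := [seq v <- V' | v \notin L].
Let outE := [seq e <- E' | e \notin edges L].

Let permV : perm_eq V' (V ++ outV).
Proof.
apply: uniq_perm; first exact: fset_uniq.
  rewrite cat_uniq filter_uniq ?fset_uniq // andbT; apply/hasPn => v.
  by rewrite mem_filter => /andP[].
move=> v; rewrite mem_cat mem_filter.
rewrite -[v \in V']/(v \in L') -[v \in V]/(v \in L).
by case: (boolP (v \in L)) => [/LL' ->|].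
Qed.

Lemma edges_sub : {subset edges L <= edges L'}.
Proof. by move=> e; rewrite !mem_edges => /andP[/LL' -> /LL' ->]. Qed.

Let permE : perm_eq E' (E ++ outE).
Proof.
apply: uniq_perm; first exact: fset_uniq.
  rewrite cat_uniq filter_uniq ?fset_uniq // andbT; apply/hasPn => v.
  by rewrite mem_filter => /andP[].
move=> e; rewrite mem_cat mem_filter.
rewrite -[e \in E']/(e \in edges L') -[e \in E]/(e \in edges L).
by case: (boolP (e \in edges L)) => [/edges_sub ->|].
Qed.

Let closed w := all (fun e => ~~ w e) outE.

(** Once the extra edges are closed, each contributes 1 - p, and each extra vertex is isolated and
    contributes 2. *)
Let csum_spins_closed (h : (vertex -> bool) -> R) w :
  {in outV, forall v s b, h (update v b s) = h s} -> closed w ->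
  csum V' (fun s => h s * \prod_(e <- E') es_factor R s e (w e)) =
  (1 - p_c R) ^+ size outE * 2 ^+ size outV *
  csum V (fun s => h s * \prod_(e <- E) es_factor R s e (w e)).
Proof.
move=> hloc /allP cw; rewrite (csum_perm _ (fset_uniq _) permV).
have prodE s : \prod_(e <- E') es_factor R s e (w e) =
    (1 - p_c R) ^+ size outE * \prod_(e <- E) es_factor R s e (w e).
  rewrite (perm_big _ permE) big_cat /= mulrC; congr (_ * _).
  rewrite (eq_big_seq (fun=> 1 - p_c R)) => [|e /cw /negbTE -> //].
  by rewrite big_const_seq count_predT -Monoid.iteropE.
under eq_csum do rewrite prodE mulrCA.
rewrite csumZ -mulrA csum_local //.
move=> v vo s b; rewrite hloc //; congr (_ * _); apply: eq_big_seq => e eE.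
have [se te] := edges_in eE; move: vo; rewrite mem_filter => /andP[vL _].
rewrite /es_factor /agree !update_other //.
  by apply: contraNneq vL => <-.
by apply: contraNneq vL => <-.
Qed.

Let csum_closed_edges (h : (vertex -> bool) -> R) :
  {in outV, forall v s b, h (update v b s) = h s} ->
  csum E' (fun w => if closed w then
     csum V' (fun s => h s * \prod_(e <- E') es_factor R s e (w e)) else 0) =
  (1 - p_c R) ^+ size outE * 2 ^+ size outV * expR (- beta_c R) ^+ size E *
  csum V (fun s => ising_weight R L s * h s).
Proof.
move=> hloc; rewrite (csum_perm _ (fset_uniq _) permE).
set g := fun w => csum V (fun s => h s * \prod_(e <- E) es_factor R s e (w e)).
set c := (1 - p_c R) ^+ size outE * 2 ^+ size outV.
transitivity (csum (E ++ outE) (fun w => if closed w then c * g w else 0)).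
  by apply: eq_csum => w; case: ifP => // cw; rewrite csum_spins_closed.
have u : uniq (E ++ outE) by rewrite -(perm_uniq permE) fset_uniq.
rewrite (csum_closed (fun w => c * g w) u) csumZ /g csum_rc_weight ?fset_uniq //.
rewrite !mulrA; congr (_ * _); apply: eq_csum => s.
by rewrite ising_weight_prod mulrC.
Qed.

(* The free measure on L is the one on L' conditioned on a decreasing event, so the
   four functions theorem compares them on increasing events. *)
Theorem fk_domination :
  gibbs_mean L (ising_weight R L) (two_spin x y) <=
  gibbs_mean (edges L') (fk_weight R L') (connect_indicator L x y).
Proof.
(* closed + connected against no condition, compared with connected against closed: the union of two
   configurations keeps the connection of the first, their intersection keeps its closed edges. *)
pose wt := fk_weight R L'; pose conn := connect_indicator L x y.
have uV' : uniq V' by exact: fset_uniq.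
have FF := @four_functions R edge E'
  (fun w => if closed w then wt w * conn w else 0) wt
  (fun w => wt w * conn w) (fun w => if closed w then wt w else 0).
have {FF} : csum E' (fun w => if closed w then wt w * conn w else 0) * csum E' wt <=
   csum E' (fun w => wt w * conn w) * csum E' (fun w => if closed w then wt w else 0).
  apply: FF => [w|w|w|w|w w'].
  - by case: ifP => // _; rewrite mulr_ge0 ?fk_weight_ge0 ?connect_indicator_ge0.
  - exact: fk_weight_ge0.
  - by rewrite mulr_ge0 ?fk_weight_ge0 ?connect_indicator_ge0.
  - by case: ifP => // _; rewrite fk_weight_ge0.
  case: ifP => cw; last first.
    rewrite mul0r; apply: mulr_ge0; last by case: ifP => // _; rewrite fk_weight_ge0.
    by rewrite mulr_ge0 ?fk_weight_ge0 ?connect_indicator_ge0.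
  have -> : closed (fun e => w e && w' e).
    by apply/allP => e /(allP cw); case: (w e).
  rewrite mulrAC [X in _ <= X]mulrAC; apply: ler_pM.
  - by rewrite mulr_ge0 ?fk_weight_ge0.
  - exact: connect_indicator_ge0.
  - by rewrite /wt !fk_weight_rc; exact: rc_weight_supermodular.
  - by apply: connect_indicator_mono => e ->.
have h1loc : {in outV, forall (v : vertex) s b, (fun=> 1 : R) (update v b s) = 1} by [].
have h2loc : {in outV, forall v s b, two_spin x y (update v b s) = two_spin x y s}.
  move=> v; rewrite mem_filter => /andP[vL _] s b.
  rewrite /two_spin !update_other //; apply: contraNneq vL => <- //.
have E1 := csum_closed_edges h1loc; have E2 := csum_closed_edges h2loc.
have -> : csum E' (fun w => if closed w then wt w else 0) =
    (1 - p_c R) ^+ size outE * 2 ^+ size outV * expR (- beta_c R) ^+ size E *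
    csum V (ising_weight R L).
  under [in RHS]eq_csum do rewrite -[ising_weight _ _ _]mulr1.
  rewrite -E1; apply: eq_csum => w; case: ifP => // _.
  rewrite /wt fk_weight_rc rc_weightE; apply: eq_csum => s; by rewrite mul1r.
have -> : csum E' (fun w => if closed w then wt w * conn w else 0) =
    (1 - p_c R) ^+ size outE * 2 ^+ size outV * expR (- beta_c R) ^+ size E *
    csum V (fun s => ising_weight R L s * two_spin x y s).
  rewrite -E2; apply: eq_csum => w; case: ifP => // cw.
  rewrite csum_spins_closed // csum_two_spins ?fset_uniq //; last exact: edges_in.
  rewrite mulrA; congr (_ * _); rewrite rc_weightE.
  have := csum_spins_closed h1loc cw.
  under eq_csum do rewrite mul1r.
  under [in RHS]eq_csum do rewrite mul1r.
  by move=> <-; rewrite /wt fk_weight_rc rc_weightE.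
set K := _ * _ * expR _ ^+ _; have K0 : 0 < K.
  by rewrite !mulr_gt0 ?exprn_gt0 ?expR_gt0 ?one_minus_p_c_gt0.
rewrite -mulrA [X in _ <= X]mulrCA ler_pM2l // => H.
rewrite /gibbs_mean ler_pdivrMr ?csum_ising_gt0 // mulrAC ler_pdivlMr ?csum_fk_gt0 //.
Qed.

End Domination.

End FiniteVolume.

(** * Infinite volume and scaling limit *)

Section LocalFunctions.
Variables (R : realType) (I : choiceType).
Implicit Types (S : {fset I}) (g : (I -> bool) -> R) (w h : I -> bool).

Definition depends_on (T : Type) S (g : (I -> bool) -> T) :=
  forall w w', {in S, w =1 w'} -> g w = g w'.

Lemma depends_on_extend (T : Type) S (g : (I -> bool) -> T) w : depends_on S g ->
  g (extend [ffun u : S => w (val u)]) = g w.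
Proof.
move=> gS; apply: gS => i iS; rewrite /extend insubT ffunE.
by rewrite SubK.
Qed.

Lemma local_sum_cylinders S g w : depends_on S g ->
  g w = \sum_(h : {ffun S -> bool}) g (extend h) * \1_(cylinder S (extend h)) w.
Proof.
move=> gS; rewrite (bigD1 [ffun u : S => w (val u)]) //= depends_on_extend //.
rewrite indicE mem_set ?mulr1 => [|i iS]; last first.
  by rewrite /extend insubT ffunE SubK.
rewrite big1 ?addr0 // => h hw; rewrite indicE memNset ?mulr0 // => cw.
case/eqP: hw; apply/ffunP => u; rewrite ffunE cw ?fsvalP //.
by rewrite extend_val.
Qed.

Lemma measurable_cylinder S h : measurable (cylinder S h : set (config I)).
Proof.
rewrite (_ : cylinder S h = \bigcap_(i in [set` S]) [set w | w i = h i]); last first.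
  by apply/seteqP; split.
apply: fin_bigcap_measurable => [|i _]; first exact: finite_fset.
by apply: sub_sigma_algebra; exists i, (h i).
Qed.

Lemma measurable_local S (A : set (config I)) :
  depends_on S A -> measurable A.
Proof.
move=> AS; rewrite (_ : A = \bigcup_(h in [set h : {ffun S -> bool} | A (extend h)])
    cylinder S (extend h)); last first.
  apply/seteqP; split => [w Aw|w [h Ah hw]].
    exists [ffun u : S => w (val u)]; first by rewrite /= depends_on_extend.
    by move=> i iS; rewrite /extend insubT ffunE SubK.
  by rewrite (AS w (extend h)).
apply: fin_bigcup_measurable => [|h _]; first exact: finite_finset.
exact: measurable_cylinder.
Qed.

Lemma integral_local (P : probability (config I) R) S g : depends_on S g ->
  (\int[P]_w (g w)%:E)%E =
  (\sum_(h : {ffun S -> bool}) g (extend h) * fine (P (cylinder S (extend h))))%:E.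
Proof.
move=> gS.
have int_cyl (h : {ffun S -> bool}) :
    P.-integrable [set: config I] (fun w => (\1_(cylinder S (extend h)) w)%:E).
  by apply: integrable_indic; exact: measurable_cylinder.
transitivity (\int[P]_w (\sum_(h : {ffun S -> bool})
    (g (extend h))%:E * (\1_(cylinder S (extend h)) w)%:E))%E.
  by apply: eq_integral => w _; rewrite (local_sum_cylinders w gS) -sumEFin.
rewrite integral_sum //; last first.
  by move=> h; apply: integrableZl => //; exact: int_cyl.
rewrite -sumEFin; apply: eq_bigr => h _.
rewrite integralZl // integral_indic //; last exact: measurable_cylinder.
by rewrite setIT EFinM fineK // fin_num_measure //; exact: measurable_cylinder.
Qed.

Lemma gibbs_mean_local (L : {fset I}) (wt : (I -> bool) -> R) S g : depends_on S g ->
  gibbs_mean L wt g =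
  \sum_(h : {ffun S -> bool}) g (extend h) * gibbs L wt (cylinder S (extend h)).
Proof.
move=> gS; rewrite /gibbs_mean.
transitivity (csum (enum_fset L) (fun w => \sum_(h : {ffun S -> bool})
    g (extend h) * (wt w * \1_(cylinder S (extend h)) w)) / csum (enum_fset L) wt).
  congr (_ / _); apply: eq_csum => w; rewrite [g w](local_sum_cylinders w gS) mulr_sumr.
  by apply: eq_bigr => h _; rewrite mulrCA.
rewrite csum_sum mulr_suml; apply: eq_bigr => h _.
by rewrite csumZ gibbsE /gibbs_mean mulrA.
Qed.

(** Weak convergence is given on cylinders only; a function of finitely many coordinates is a finite
    combination of their indicators. *)
Lemma local_limit (L : nat -> {fset I}) (wt : nat -> (I -> bool) -> R)
    (P : probability (config I) R) S g :
  infinite_volume_limit (fun N => gibbs (L N) (wt N)) P -> depends_on S g ->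
  gibbs_mean (L N) (wt N) g @[N --> \oo] --> fine (\int[P]_w (g w)%:E).
Proof.
move=> lim gS; rewrite (integral_local _ gS) /=.
under eq_fun do rewrite (gibbs_mean_local _ _ gS).
apply: cvg_big => [|h _]; first exact: add_continuous.
by apply: cvgMl_tmp; exact: lim.
Qed.

End LocalFunctions.

Section PfaffianLimit.
Variable R : realType.

Lemma pfaffian_cvg (T : Type) (F : set_system T) (FF : Filter F) n
    (A : T -> 'M[R]_(n.*2)) (B : 'M[R]_(n.*2)) :
  (forall i j, A t i j @[t --> F] --> B i j) ->
  pfaffian (A t) @[t --> F] --> pfaffian B.
Proof.
move=> AB; rewrite /pfaffian; apply: cvgMl_tmp.
apply: cvg_big => [|s _]; first exact: add_continuous.
apply: cvgMl_tmp; apply: cvg_big => [|i _]; first exact: mul_continuous.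
exact: AB.
Qed.

End PfaffianLimit.

Section BoundaryBox.
Variable R : realType.

Definition boundary_spins m (k : 'I_m -> int) (s : vertex -> bool) : R :=
  \prod_(j < m) spin R (s (bdry (k j))).

Lemma box_sub N N' : (N <= N')%N -> {subset box N <= box N'}.
Proof. by move=> NN' [k j]; rewrite !mem_box; lia. Qed.

Lemma box_pfaffian N n (k : 'I_(n.*2) -> int) :
  (forall i j : 'I_(n.*2), (i < j)%N -> k i < k j) ->
  (forall j, absz (k j) <= N)%N ->
  gibbs_mean (box N) (ising_weight R (box N)) (boundary_spins k) =
  pfaffian (antisym_mx (fun i j => gibbs_mean (box N) (ising_weight R (box N))
                                     (two_spin R (bdry (k i)) (bdry (k j))))).
Proof.
move=> kinc kN; set V := enum_fset (box N); set W := ising_weight R (box N).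
(* The horizontal coordinate shifted by N is the column index, from 0 to 2N, that labels the bottom
   row. *)
have KN j : (absz (k j + Posz N)%R < N.*2.+1)%N by have := kN j; lia.
pose K j : 'I_(N.*2.+1) := Ordinal (KN j).
have Kinc : {homo K : i j / (i < j)%N}.
  by move=> i j /kinc; rewrite /K /=; have := kN i; have := kN j; lia.
have Kinj : injective K.
  move=> i j e; apply/val_inj; case: (ltngtP i j) => // /Kinc; by rewrite e ltnn.
have rowK j : row 0 (K j) = bdry (k j).
  by rewrite /row /bdry /column /=; congr (_, _); have := kN j; lia.
pose f := spin_sum (R := R) V W (@row N 0).
have f0 : f finset.set0 = csum V W.
  by apply: eq_csum => s; rewrite finset.big_set0 mulr1.
have f0n : f finset.set0 != 0 by rewrite f0 gt_eqF // csum_ising_gt0.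
have := plucker_pfaffian (@plucker_ising_box R N) f0n Kinc.
rewrite -/f f0 => E; transitivity (f (K @: [set: _])%SET / csum V W).
  congr (_ / _); apply: eq_csum => s; congr (_ * _).
  rewrite big_imset /=; last by move=> i j _ _; apply: Kinj.
  by apply: eq_big => [j|j _]; rewrite ?inE ?rowK.
rewrite E; congr pfaffian; apply/matrixP => i j; rewrite !mxE.
have pairE (i' j' : 'I_(n.*2)) : i' != j' -> f [set K i'; K j']%SET / csum V W =
    gibbs_mean (box N) W (two_spin R (bdry (k i')) (bdry (k j'))).
  move=> ij; congr (_ / _); apply: eq_csum => s; congr (_ * _).
  by rewrite finset.big_setU1 ?finset.big_set1 ?inE ?(inj_eq Kinj) //= !rowK.
by case: (eqVneq i j) => // ij; rewrite !pairE // eq_sym.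
Qed.

End BoundaryBox.

Section InfiniteVolume.
Variable R : realType.
Variable P_ising : probability (config vertex) R.
Hypothesis hP_ising : half_plane_ising_free P_ising.

Definition correlation (g : (vertex -> bool) -> R) : R :=
  fine (\int[P_ising]_s (g s)%:E).

Lemma ising_local_limit (S : {fset vertex}) g : depends_on S g ->
  gibbs_mean (box N) (ising_weight R (box N)) g @[N --> \oo] --> correlation g.
Proof. by move=> gS; apply: local_limit gS; exact: hP_ising. Qed.

Lemma two_spin_local x y : depends_on [fset x; y]%fset (two_spin R x y).
Proof. by move=> s s' ss'; rewrite /two_spin !ss' // !inE eqxx ?orbT. Qed.

Lemma boundary_spins_local m (k : 'I_m -> int) :
  depends_on [fset bdry (k j) | j in 'I_m]%fset (boundary_spins R k).
Proof.
move=> s s' ss'; apply: eq_bigr => j _; rewrite ss' //.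
by apply/imfsetP; exists j.
Qed.

Lemma correlation_pfaffian n (k : 'I_(n.*2) -> int) :
  (forall i j : 'I_(n.*2), (i < j)%N -> k i < k j) ->
  correlation (boundary_spins R k) =
  pfaffian (antisym_mx (fun i j => correlation (two_spin R (bdry (k i)) (bdry (k j))))).
Proof.
move=> kinc; have lim := ising_local_limit (@boundary_spins_local _ k).
apply/esym; apply: cvg_unique lim; first exact: Rhausdorff.
have : pfaffian (antisym_mx (fun i j => gibbs_mean (box N) (ising_weight R (box N))
                  (two_spin R (bdry (k i)) (bdry (k j))))) @[N --> \oo] -->
    pfaffian (antisym_mx (fun i j => correlation (two_spin R (bdry (k i)) (bdry (k j))))).
  apply: pfaffian_cvg => i j; rewrite mxE; under eq_fun do rewrite mxE.
  case: ifP => _; first exact: cvg_cst.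
  case: ifP => _; last apply: cvgN; exact: (ising_local_limit (@two_spin_local _ _)).
apply: cvg_trans; apply: near_eq_cvg.
near=> N; rewrite box_pfaffian // => j.
apply: leq_trans (_ : \max_j absz (k j) <= N)%N; first exact: leq_bigmax.
near: N; exact: nbhs_infty_ge.
Unshelve. all: by end_near. Qed.

Variable P_fk : probability (config edge) R.
Hypothesis hP_fk : half_plane_fk_free P_fk.

Lemma connect_indicator_local L x y : depends_on (edges L) (connect_indicator R L x y).
Proof.
move=> w w' ww'; rewrite /connect_indicator /connected_in.
suff -> : (fun e => w e && (e \in enum_fset (edges L))) =
          (fun e => w' e && (e \in enum_fset (edges L))) by [].
apply/funext => e; case: (boolP (e \in _)) => [eL|]; last by rewrite !andbF.
by rewrite ww'.
Qed.

Definition box_connected x y M : set (config edge) :=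
  [set w | connected_in (enum_fset (edges (box M))) w x y].

Lemma measurable_box_connected x y M : measurable (box_connected x y M).
Proof.
apply: (@measurable_local _ (edges (box M))) => w w' ww'.
rewrite /box_connected /= /connected_in.
suff -> : (fun e => w e && (e \in enum_fset (edges (box M)))) =
          (fun e => w' e && (e \in enum_fset (edges (box M)))) by [].
apply/funext => e; case: (boolP (e \in _)) => [eL|]; last by rewrite !andbF.
by rewrite ww'.
Qed.

Lemma fk_local_limit M x y :
  gibbs_mean (edges (box N)) (fk_weight R (box N)) (connect_indicator R (box M) x y)
    @[N --> \oo] --> fine (P_fk (box_connected x y M)).
Proof.
have -> : fine (P_fk (box_connected x y M)) =
    fine (\int[P_fk]_w (connect_indicator R (box M) x y w)%:E).
  congr fine; rewrite -[box_connected _ _ _]setIT -integral_indic //.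
  exact: measurable_box_connected.
apply: (@local_limit _ _ (fun N => edges (box N)) (fun N => fk_weight R (box N)) _ _ _ hP_fk).
exact: connect_indicator_local.
Qed.

Lemma box_connected_sub x y M M' : (M <= M')%N -> box_connected x y M `<=` box_connected x y M'.
Proof.
move=> MM' w; apply: connected_event_mono => e /andP[-> /=].
exact: (edges_sub (box_sub MM')).
Qed.

(** An open path has finitely many edges, so it lies in some box. *)
Lemma bigcup_box_connected x y : \bigcup_M box_connected x y M = connected_event x y.
Proof.
apply/seteqP; split => [w [M _]|w [p [pw <-]]].
  by apply: connected_event_mono => e /andP[].
elim: p x pw => [|v p IH] x /=; first by exists 0%N => //; exists [::].
case/andP => /open_adjacentP[e [we uv]] /IH[M _ [q [qw ql]]].
have [M' eM'] : exists M', e \in edges (box M').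
  have inbox (u : vertex) : exists M', u \in box M'.
    by case: u => c d; exists (absz c + d)%N; rewrite mem_box; lia.
  have [M1 s1] := inbox (src e); have [M2 t2] := inbox (tgt e).
  exists (maxn M1 M2); rewrite mem_edges.
  by rewrite (box_sub (leq_maxl _ _) s1) (box_sub (leq_maxr _ _) t2).
exists (maxn M M') => //; exists (v :: q); split=> //=.
rewrite (sub_path _ qw) ?andbT; last first.
  apply: sub_open_adjacent => f /andP[-> /=].
  exact: (edges_sub (box_sub (leq_maxl _ _))).
apply/open_adjacentP; exists e; split=> //; rewrite we /=.
exact: (edges_sub (box_sub (leq_maxr M M'))).
Qed.

Theorem two_spin_connected x y :
  correlation (two_spin R x y) = fine (P_fk (connected_event x y)).
Proof.
have inbox (u : vertex) : \forall N \near \oo, u \in box N.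
  case: u => c d; exists (absz c + d)%N => // N /= cdN.
  by rewrite mem_box; lia.
have mconn M := measurable_box_connected x y M.
have limP : fine (P_fk (box_connected x y M)) @[M --> \oo] --> fine (P_fk (connected_event x y)).
  apply: fine_cvg; rewrite fineK ?fin_num_measure //; last first.
    by rewrite -bigcup_box_connected; exact: bigcup_measurable.
  rewrite -bigcup_box_connected; apply: nondecreasing_cvg_mu => //.
    exact: bigcup_measurable.
  by move=> M M' MM'; apply/subsetPset; exact: box_connected_sub.
have limE := ising_local_limit (@two_spin_local x y).
apply/le_anti/andP; split.
  (* Upper bound: by domination the Ising expectation in box N is at most the probability, in each
     larger box N', of a connection inside box N. There N' tends to infinity first, then N. *)
  apply: ler_cvg_to limE limP _; near=> N.
  have xN : x \in box N by near: N; exact: inbox.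
  have yN : y \in box N by near: N; exact: inbox.
  apply: cvgr_to_ge (@fk_local_limit N x y) _; near=> N'.
  apply: fk_domination => //; apply: box_sub.
  by near: N'; exact: nbhs_infty_ge.
(* Lower bound: within the same measure on box N, a connection inside a smaller box M implies one
   inside N, whose probability is the Ising expectation. *)
apply: cvgr_to_le limP _; near=> M.
apply: ler_cvg_to (@fk_local_limit M x y) limE _; near=> N.
have xN : x \in box N by near: N; exact: inbox.
have yN : y \in box N by near: N; exact: inbox.
rewrite -edwards_sokal // /gibbs_mean ler_pM2r ?invr_gt0 ?csum_fk_gt0 //.
apply: ler_csum => w; apply: ler_wpM2l; first exact: fk_weight_ge0.
apply: connect_indicator_sub; apply: edges_sub; apply: box_sub.
by near: N; exact: nbhs_infty_ge.
Unshelve. all: by end_near. Qed.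

Variable C4 : R.
Hypothesis hC4 : is_C4 P_fk C4.

(** The Pfaffian is homogeneous of degree n in its entries, so a^(-n) becomes a factor 1/a on each
    entry, and [is_C4] gives the limit of each. *)
Theorem scaling_limit n (x : 'rV[R]_(n.*2)) (k : 'I_(n.*2) -> R -> int) :
  increasing x ->
  (forall a : R, 0 < a -> forall i j : 'I_(n.*2), (i < j)%N -> k i a < k j a) ->
  (forall j, approximates (k j) (x 0 j)) ->
  scaled_correlation P_ising k a @[a --> 0^'+] --> C4 ^+ n * pfaffian (cauchy_mx x).
Proof.
move=> xinc kinc kx; rewrite -pfaffianZ.
pose A (a : R) := antisym_mx (fun i j : 'I_(n.*2) =>
  a^-1 * fine (P_fk (connected_event (bdry (k i a)) (bdry (k j a))))).
have : pfaffian (A a) @[a --> 0^'+] --> pfaffian (C4 *: cauchy_mx x).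
  have lim (i j : 'I_(n.*2)) : (i < j)%N ->
     a^-1 * fine (P_fk (connected_event (bdry (k i a)) (bdry (k j a)))) @[a --> 0^'+]
       --> C4 * (x 0 j - x 0 i)^-1.
    move=> ij; have xij := xinc _ _ ij.
    rewrite -(ger0_norm (ltW (_ : 0 < x 0 j - x 0 i))) ?subr_gt0 // distrC.
    by apply: hC4.2 => //; rewrite lt_eqF.
  apply: pfaffian_cvg => i j; under eq_fun do rewrite /A mxE.
  rewrite !mxE; case: (eqVneq i j) => ij; first by rewrite mulr0; exact: cvg_cst.
  case: ltnP => lij; first exact: lim.
  have lji : (j < i)%N by rewrite ltn_neqAle lij andbT eq_sym.
  rewrite -opprB invrN mulrN; apply: cvgN; exact: lim.
apply: cvg_trans; apply: near_eq_cvg; near=> a.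
have a0 : 0 < a by near: a; exact: nbhs_right_gt.
have -> : A a = a^-1 *: antisym_mx (fun i j : 'I_(n.*2) =>
    correlation (two_spin R (bdry (k i a)) (bdry (k j a)))).
  apply/matrixP => i j; rewrite !mxE !two_spin_connected.
  by case: ifP => _; [rewrite mulr0|case: ifP; rewrite ?mulrN].
rewrite pfaffianZ exprVn -correlation_pfaffian; last exact: kinc.
by rewrite /scaled_correlation expectation.unlock.
Unshelve. all: by end_near. Qed.

End InfiniteVolume.

(** * The differential equation *)

Section LogarithmicDerivative.
Variables (R : realType) (V : normedModType R).
Implicit Types (x v : V).

Lemma is_derive_inverse (f : V -> R) x v df : f x != 0 ->
  is_derive x v f df -> is_derive x v (fun y => (f y)^-1) (- (f x) ^- 2 * df).
Proof.
move=> fx0 [fd <-]; apply: DeriveDef; first exact: derivableV.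
exact: deriveV.
Qed.

(** In terms of logarithmic derivatives the product rule keeps the whole product, with no factor
    removed. *)
Lemma is_derive_prod (J : Type) (r : seq J) (g : J -> V -> R) (l : J -> R) x v :
  (forall j, is_derive x v (g j) (g j x * l j)) ->
  is_derive x v (fun y => \prod_(j <- r) g j y) (\prod_(j <- r) g j x * \sum_(j <- r) l j).
Proof.
move=> gl; elim: r => [|j r IH].
  rewrite !big_nil mulr0; under eq_fun do rewrite big_nil.
  exact: is_derive_cst.
under eq_fun do rewrite big_cons.
apply: is_derive_eq (is_deriveM (gl j) IH) _.
rewrite !big_cons; set p := \prod_(_ <- _) _; set s := \sum_(_ <- _) _.
by rewrite -![_ *: _]/(_ * _); ring.
Qed.

Lemma is_derive_lincomb (J : Type) (r : seq J) (c : J -> R) (g : J -> V -> R)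
    (dg : J -> R) x v : (forall j, is_derive x v (g j) (dg j)) ->
  is_derive x v (fun y => \sum_(j <- r) c j * g j y) (\sum_(j <- r) c j * dg j).
Proof.
move=> gd; elim: r => [|j r IH].
  rewrite !big_nil; under eq_fun do rewrite big_nil.
  exact: is_derive_cst.
rewrite big_cons; under eq_fun do rewrite big_cons.
exact: is_deriveD (is_deriveZ (c j) (gd j)) IH.
Qed.

End LogarithmicDerivative.

Lemma is_derive_coord (R : realType) m (i : 'I_m) (x v : 'rV[R]_m) :
  is_derive x v (fun y : 'rV[R]_m => y 0 i) (v 0 i).
Proof.
have lim : h^-1 *: (((fun y : 'rV[R]_m => y 0 i) \o shift x) (h *: v) - x 0 i)
    @[h --> 0^'] --> v 0 i.
  have : (fun=> v 0 i) @ (0 : R)^' --> v 0 i by exact: cvg_cst.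
  apply: cvg_trans; apply: near_eq_cvg; near=> h => /=.
  have h0 : h != 0 by near: h; exact: nbhs_dnbhs_neq.
  by rewrite !mxE addrK -[_ *: _]/(_ * _) mulKf.
apply: DeriveDef; first by apply/cvg_ex; exists (v 0 i).
exact: cvg_lim lim.
Unshelve. all: by end_near. Qed.

Section PositionPairs.
Variable n : nat.
Let m := n.*2.

Definition ev (i : 'I_n) : 'I_m := Ordinal (double_lt i).
Definition od (i : 'I_n) : 'I_m := Ordinal (doubleS_lt i).

Lemma half_lt (p : 'I_m) : ((val p)./2 < n)%N.
Proof. by rewrite ltn_half_double; exact: ltn_ord. Qed.

Definition half (p : 'I_m) : 'I_n := Ordinal (half_lt p).
(** The other position of the same pair; conjugated by a permutation it becomes the [partner] map on
    points. *)
Definition flip (p : 'I_m) : 'I_m := if odd p then ev (half p) else od (half p).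

Lemma half_ev i : half (ev i) = i.
Proof. by apply: val_inj; rewrite /= doubleK. Qed.

Lemma half_od i : half (od i) = i.
Proof. by apply: val_inj; rewrite /= uphalf_double. Qed.

Lemma odd_ev i : odd (ev i) = false.
Proof. by rewrite /= odd_double. Qed.

Lemma odd_od i : odd (od i) = true.
Proof. by rewrite /= odd_double. Qed.

Lemma flip_ev i : flip (ev i) = od i.
Proof. by rewrite /flip odd_ev half_ev. Qed.

Lemma flip_od i : flip (od i) = ev i.
Proof. by rewrite /flip odd_od half_od. Qed.

Lemma evenP (p : 'I_m) : odd p = false -> p = ev (half p).
Proof. by move=> po; apply: val_inj; rewrite /= -[LHS](odd_double_half p) po. Qed.

Lemma oddP (p : 'I_m) : odd p -> p = od (half p).
Proof. by move=> po; apply: val_inj; rewrite /= -[LHS](odd_double_half p) po. Qed.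

Lemma flipK : involutive flip.
Proof.
move=> p; case po : (odd p).
  by rewrite (oddP po) flip_od flip_ev.
by rewrite (evenP po) flip_ev flip_od.
Qed.

Lemma position_case (p : 'I_m) : (exists i, p = ev i) \/ (exists i, p = od i).
Proof.
case po : (odd p); [right|left]; exists (half p); [exact: oddP|exact: evenP].
Qed.

Lemma ev_od_neq i j : (ev i == od j) = false.
Proof. by apply/negbTE/eqP => /(congr1 (fun p : 'I_m => odd p)); rewrite odd_ev odd_od. Qed.

Lemma odd_flip p : odd (flip p) = ~~ odd p.
Proof. by rewrite {1}/flip; case: ifP; rewrite ?odd_ev ?odd_od. Qed.

Lemma flip_neq p : flip p != p.
Proof. by apply/eqP => /(congr1 (fun q : 'I_m => odd q)); rewrite odd_flip; case: (odd p). Qed.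

Lemma half_eqP p q : half p = half q -> q = p \/ q = flip p.
Proof.
case po : (odd p); case qo : (odd q).
- by rewrite (oddP po) (oddP qo) !half_od => ->; left.
- by rewrite (oddP po) (evenP qo) half_od half_ev flip_od => ->; right.
- by rewrite (evenP po) (oddP qo) half_od half_ev flip_ev => ->; right.
- by rewrite (evenP po) (evenP qo) !half_ev => ->; left.
Qed.

End PositionPairs.

Section PairingTerms.
Variables (R : realType) (n : nat).
Let m := n.*2.
Implicit Types (s : 'S_m) (x : 'rV[R]_m) (p q : 'I_m) (i : 'I_n).

Definition distinct x := forall a b : 'I_m, a != b -> x 0 a != x 0 b.

Definition pairing_term s x : R := \prod_(i < n) (x 0 (s (od i)) - x 0 (s (ev i)))^-1.

Definition partner s (k : 'I_m) : 'I_m := s (flip ((s^-1)%g k)).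

(** The logarithmic derivative of [pairing_term s] in the coordinate k, whichever of the two points
    of its pair k is. *)
Definition pole s k x : R := (x 0 (partner s k) - x 0 k)^-1.

Lemma partnerE s p : partner s (s p) = s (flip p).
Proof. by rewrite /partner permK. Qed.

Lemma partnerK s : involutive (partner s).
Proof. by move=> k; rewrite /partner permK flipK permKV. Qed.

Lemma partner_neq s k : partner s k != k.
Proof.
rewrite /partner -{2}(permKV s k) (inj_eq perm_inj).
exact: flip_neq.
Qed.

Lemma pairing_term_cauchy s x :
  pairing_term s x = \prod_(i < n) cauchy_mx x (s (Ordinal (double_lt i))) (s (Ordinal (doubleS_lt i))).
Proof.
apply: eq_bigr => i _; rewrite mxE (inj_eq perm_inj) -[Ordinal _ == _]/(ev i == od i).
case: eqP => [/(congr1 (fun p : 'I_m => odd p))|//].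
by rewrite odd_ev odd_od.
Qed.

Lemma is_derive_pairing_term s k x : distinct x ->
  is_derive x 'e_k (pairing_term s) (pairing_term s x * pole s k x).
Proof.
move=> xd; pose d i := x 0 (s (od i)) - x 0 (s (ev i)).
(* [e p] is the derivative of the coordinate at position p, and [l i] the logarithmic derivative of
   the i-th factor; only the pair containing k contributes. *)
pose e p : R := (s p == k)%:R.
have d0 i : d i != 0 by rewrite subr_eq0 xd // (inj_eq perm_inj) -flip_ev flip_neq.
pose l i := - (d i)^-1 * (e (od i) - e (ev i)).
have -> : pole s k x = \sum_(i < n) l i.
  pose p := (s^-1)%g k; have kE : k = s p by rewrite permKV.
  rewrite (bigD1 (half p)) //= big1 ?addr0 => [|i ik].
    rewrite /pole /l /d /e kE partnerE !(inj_eq perm_inj).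
    have [[i ->]|[i ->]] := position_case p.
      by rewrite flip_ev half_ev eqxx eq_sym ev_od_neq sub0r mulrN1 opprK.
    by rewrite flip_od half_od eqxx ev_od_neq subr0 mulr1 -invrN opprB.
  rewrite /l /e kE; have ne q : half q = i -> (s q == s p) = false.
    move=> hq; rewrite (inj_eq perm_inj); apply/negbTE.
    by apply: contraNneq ik => <-; rewrite hq.
  by rewrite !ne ?half_od ?half_ev // subrr mulr0.
apply: (@is_derive_prod R 'rV[R]_m _ _ (fun i (y : 'rV[R]_m) => (y 0 (s (od i)) - y 0 (s (ev i)))^-1) l) => i.
have D : is_derive x 'e_k (fun y : 'rV[R]_m => y 0 (s (od i)) - y 0 (s (ev i)))
    (e (od i) - e (ev i)).
  have := is_deriveB (is_derive_coord (s (od i)) x 'e_k) (is_derive_coord (s (ev i)) x 'e_k).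
  by rewrite !mxE !eqxx.
have := @is_derive_inverse R 'rV[R]_m (fun y : 'rV[R]_m => y 0 (s (od i)) - y 0 (s (ev i))) x 'e_k _ (d0 i) D.
move=> H; apply: is_derive_eq H _.
by rewrite /l expr2 invfM; ring.
Qed.

End PairingTerms.

Section BPZ.
Variables (R : realType) (n : nat).
Let m := n.*2.
Implicit Types (s : 'S_m) (x : 'rV[R]_m) (j k : 'I_m).

(** The second derivative requires the formula for the first one in a neighbourhood of x. *)
Lemma near_distinct x : distinct x -> \forall y \near x, distinct y.
Proof.
move=> xd; have H (ab : 'I_m * 'I_m) : \forall y \near x,
    ab.1 != ab.2 -> (y : 'rV[R]_m) 0 ab.1 != y 0 ab.2.
  case: ab => a b /=; case: (eqVneq a b) => [ab|ab]; first by apply: (@nearW _ (nbhs x) _ (nbhs_filter x)) => y; rewrite ?ab ?eqxx.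
  have : y 0 a - y 0 b @[y --> x] --> x 0 a - x 0 b.
    by apply: cvgB; exact: coord_continuous.
  move/cvgr_neq0; rewrite subr_eq0 => /(_ (xd a b ab)).
  by apply: (@filterS _ (nbhs x) (nbhs_filter x)) => y + _; rewrite subr_eq0.
have := @filter_forall _ _ _ (nbhs x) (nbhs_filter x) H.
apply: (@filterS _ (nbhs x) (nbhs_filter x)) => y Hy a b; exact: (Hy (a, b)).
Qed.

Lemma is_derive_pole s j x : distinct x ->
  is_derive x 'e_j (pole s j) (pole s j x ^+ 2).
Proof.
move=> xd; have d0 : x 0 (partner s j) - x 0 j != 0.
  by rewrite subr_eq0 xd ?partner_neq.
have D : is_derive x 'e_j (fun y : 'rV[R]_m => y 0 (partner s j) - y 0 j) (-1).
  have := is_deriveB (is_derive_coord (partner s j) x 'e_j) (is_derive_coord j x 'e_j).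
  by rewrite !mxE !eqxx (negbTE (partner_neq _ _)) sub0r.
have := @is_derive_inverse R 'rV[R]_m (fun y : 'rV[R]_m => y 0 (partner s j) - y 0 j)
  x 'e_j _ d0 D.
by rewrite mulrN1 opprK -exprVn.
Qed.

Lemma is_derive2_pairing_term s j x : distinct x ->
  is_derive x 'e_j (fun y => pairing_term s y * pole s j y)
    (2 * pairing_term s x * pole s j x ^+ 2).
Proof.
move=> xd.
apply: is_derive_eq (is_deriveM (is_derive_pairing_term s j xd) (is_derive_pole s j xd)) _.
by rewrite -![_ *: _]/(_ * _); ring.
Qed.

Definition pairing_sum (c : 'S_m -> R) (x : 'rV[R]_m) : R := \sum_s c s * pairing_term s x.

Lemma is_derive_pairing_sum c k x : distinct x ->
  is_derive x 'e_k (pairing_sum c) (\sum_s c s * (pairing_term s x * pole s k x)).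
Proof.
by move=> xd; apply: is_derive_lincomb => s; exact: is_derive_pairing_term.
Qed.

Lemma is_derive2_pairing_sum c j x : distinct x ->
  is_derive x 'e_j ('D_('e_j) (pairing_sum c))
    (\sum_s c s * (2 * pairing_term s x * pole s j x ^+ 2)).
Proof.
move=> xd.
have H : is_derive x 'e_j (fun y => \sum_s c s * (pairing_term s y * pole s j y))
    (\sum_s c s * (2 * pairing_term s x * pole s j x ^+ 2)).
  apply: (@is_derive_lincomb R 'rV[R]_m _ _ c (fun s y => pairing_term s y * pole s j y)) => s.
  exact: is_derive2_pairing_term.
apply: near_eq_is_derive H; have := near_distinct xd; apply: filterS => y yd.
by have [_ ->] := is_derive_pairing_sum c j yd.
Qed.

Section Cancellation.
Variables (x : 'rV[R]_m) (j : 'I_m).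
Hypothesis xd : distinct x.

Let r k : R := (x 0 k - x 0 j)^-1.

(** Partial fractions: r_k - r_l = (x_l - x_k) r_k r_l. *)
Let r_sub k l : k != j -> l != j -> k != l ->
  (x 0 l - x 0 k)^-1 * (r k - r l) = r k * r l.
Proof.
move=> kj lj kl; rewrite /r; field.
by rewrite !subr_eq0 !xd // eq_sym.
Qed.

Let pole_j s : pole s j x = r (partner s j). Proof. by []. Qed.

(** The operator applied to one pairing term, divided by that term; 3 is 3/2 times the 2 of the
    second derivative. *)
Let bracket s : R :=
  3 * pole s j x ^+ 2 + \sum_(k | k != j) (2 * r k * pole s k x - r k ^+ 2).

(** The partner of j contributes -2 - 1 against the leading 3. For the other points, the doubled sum
    is symmetrised over k and its partner k'; their poles are opposite, and r_k - r_k' over x_k' -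
    x_k is r_k r_k'. *)
Let bracketE s :
  bracket s = \sum_(k | (k != j) && (k != partner s j)) (r k * r (partner s k) - r k ^+ 2).
Proof.
set l := partner s j; have lj : l != j by exact: partner_neq.
rewrite /bracket (bigD1 l) //= [pole s l x]/pole partnerK -/l pole_j -/l.
have -> : (x 0 j - x 0 l)^-1 = - r l by rewrite /r -invrN opprB.
rewrite addrA [X in X + _ = _](_ : _ = 0) ?add0r; last by ring.
rewrite !sumrB; congr (_ - _).
have pres k : (k != j) && (k != l) = (partner s k != j) && (partner s k != l).
  rewrite andbC; congr (_ && _).
    by rewrite (can2_eq (partnerK s) (partnerK s)).
  by rewrite /l (inj_eq (inv_inj (partnerK s))).
have sw : \sum_(k | (k != j) && (k != l)) r k * pole s k x =
    \sum_(k | (k != j) && (k != l)) r (partner s k) * pole s (partner s k) x.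
  rewrite (reindex_inj (inv_inj (partnerK s))) /=.
  by apply: eq_bigl => k; rewrite -pres.
transitivity (\sum_(k | (k != j) && (k != l)) r k * pole s k x +
              \sum_(k | (k != j) && (k != l)) r (partner s k) * pole s (partner s k) x).
  by rewrite -sw -big_split; apply: eq_bigr => k _ /=; ring.
rewrite -big_split; apply: eq_bigr => k kP /=; have := kP; rewrite pres => /andP[pj pl].
case/andP: kP => kj kl.
rewrite -(r_sub kj pj); last by rewrite eq_sym partner_neq.
rewrite /pole partnerK -[(x 0 k - _)^-1]opprK -invrN opprB; ring.
Qed.

(* For a fixed third point k, exchanging the partners of j and k is a sign-reversing
   involution of the pairings that leaves the summand unchanged. *)
Let cancel_positions p q k : q != p -> q != flip p -> k != j ->
  \sum_(s : 'S_m | (s p == j) && (s q == k))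
     (-1) ^+ s * (pairing_term s x * (r k * r (s (flip q)) - r k ^+ 2)) = 0.
Proof.
move=> qp qfp kj; set t := tperm (flip p) (flip q).
(* The sign that orients the factor of a pair from the point at position a to its partner. *)
pose eps (a : 'I_m) : R := (-1) ^+ (odd a).
pose rest s : R := \prod_(i < n | (i != half p) && (i != half q))
   (x 0 (s (od i)) - x 0 (s (ev i)))^-1.
have hqp : half q != half p.
  by apply/eqP => /esym/half_eqP[e|e]; [rewrite e eqxx in qp|rewrite e eqxx in qfp].
have factor s a : (x 0 (s (od (half a))) - x 0 (s (ev (half a))))^-1 =
    eps a * (x 0 (s (flip a)) - x 0 (s a))^-1.
  rewrite /eps; have [[i ->]|[i ->]] := position_case a.
    by rewrite half_ev flip_ev odd_ev mul1r.
  by rewrite half_od flip_od odd_od expr1 mulN1r -invrN opprB.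
have fpq : flip p != flip q by rewrite (inj_eq (inv_inj (@flipK n))) eq_sym.
have fqp : flip q != p by rewrite (can2_eq (@flipK n) (@flipK n)).
(* The bracket cancels the pole between k and its partner; what remains is symmetric in the partners
   of j and k. *)
have termE s : s p = j -> s q = k ->
    pairing_term s x * (r k * r (s (flip q)) - r k ^+ 2) =
    - (eps p * eps q * r k ^+ 2 * (r (s (flip p)) * r (s (flip q))) * rest s).
  move=> sp sq; rewrite /pairing_term (bigD1 (half p)) //= (bigD1 (half q)) //=.
  rewrite !factor sp sq -/(rest s) -[(x 0 (s (flip p)) - x 0 j)^-1]/(r _).
  have lj : s (flip q) != j by rewrite -sp (inj_eq perm_inj).
  have lk : k != s (flip q) by rewrite -sq (inj_eq perm_inj) eq_sym flip_neq.
  have := r_sub kj lj lk; move: (_^-1) => u E.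
  have -> : eps p * r (s (flip p)) * (eps q * u * rest s) * (r k * r (s (flip q)) - r k ^+ 2) =
    - (eps p * eps q * r k * r (s (flip p)) * rest s * (u * (r k - r (s (flip q))))) by ring.
  by rewrite E; ring.
set S := \sum_(s | _) _; suff SN : S = - S.
  by move/eqP: SN; rewrite -addr_eq0 -mulr2n mulrn_eq0 /= => /eqP.
(* Composing with t first exchanges the contents of the positions paired with p and q and leaves j
   and k in place. *)
rewrite {1}/S (reindex_inj (mulgI t)) -sumrN.
have tp : t p = p by rewrite tpermD // ?flip_neq.
have tq : t q = q by rewrite tpermD // ?flip_neq // eq_sym.
apply: eq_big => [s|s /andP[]]; first by rewrite !permM tp tq.
rewrite !permM tp tq => /eqP sp /eqP sq.
have sp' : (t * s)%g p = j by rewrite permM tp.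
have sq' : (t * s)%g q = k by rewrite permM tq.
have restE : rest (t * s)%g = rest s.
  apply: eq_bigr => i /andP[ip iq].
  have fixed a : half a = i -> (t * s)%g a = s a.
    move=> ai; rewrite permM tpermD //.
      apply: contraNneq ip => pa; rewrite -ai -pa /flip.
      by case: ifP => _; rewrite ?half_ev ?half_od.
    apply: contraNneq iq => qa; rewrite -ai -qa /flip.
    by case: ifP => _; rewrite ?half_ev ?half_od.
  by rewrite !fixed ?half_od ?half_ev.
have := termE _ sp' sq'; rewrite !permM tpermL tpermR => ->.
rewrite (termE _ sp sq) restE.
have -> : (-1) ^+ (t * s)%g = - (-1) ^+ s :> R.
  by rewrite odd_permM odd_tperm fpq addTb signrN.
rewrite mulNr; congr (- (_ * - (_ * _))).
by rewrite [r (s (flip q)) * _]mulrC.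
Qed.

(** The permutations are sorted by the positions p and q of j and k. The class q = p is empty, and q
    = [flip p] is excluded because k is not the partner of j. *)
Let cancel_point k : k != j ->
  \sum_(s : 'S_m | k != partner s j)
     (-1) ^+ s * (pairing_term s x * (r k * r (partner s k) - r k ^+ 2)) = 0.
Proof.
move=> kj.
rewrite (partition_big (fun s : 'S_m => ((s^-1)%g j, (s^-1)%g k)) xpredT) //=.
apply: big1 => -[p q] _; case: (eqVneq q p) => [->|qp].
  apply: big1 => s /andP[_ /eqP[sj sk]]; case/eqP: kj; apply: (@perm_inj _ (s^-1)%g).
  by rewrite sj sk.
case: (eqVneq q (flip p)) => [->|qfp].
  apply: big1 => s /andP[+ /eqP[sj sk]]; rewrite /partner sj -sk permKV eqxx //.
rewrite -[RHS](cancel_positions qp qfp kj); apply: eq_big => s.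
  apply/andP/andP => [[_ /eqP[<- <-]]|[/eqP sp /eqP sq]]; first by rewrite !permKV.
  by rewrite -sp -sq !permK partnerE (inj_eq perm_inj).
by case/andP => _ /eqP[_ sk]; rewrite /partner sk.
Qed.

Lemma bpz_cancellation :
  \sum_(s : 'S_m) (-1) ^+ s * (pairing_term s x * bracket s) = 0.
Proof.
transitivity (\sum_(s : 'S_m) \sum_(k | k != j)
    if k != partner s j then
      (-1) ^+ s * (pairing_term s x * (r k * r (partner s k) - r k ^+ 2)) else 0).
  apply: eq_bigr => s _; rewrite bracketE -big_mkcondr !mulr_sumr.
  by apply: eq_bigr => k _.
rewrite exchange_big /=; apply: big1 => k kj.
by rewrite -big_mkcond /=; exact: cancel_point.
Qed.

End Cancellation.

Theorem bpz_pairing_sum (c : R) x j : distinct x ->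
  bpz_operator j (pairing_sum (fun s => c * (-1) ^+ s)) x = 0.
Proof.
move=> xd; rewrite /bpz_operator.
have [_ ->] := is_derive2_pairing_sum (fun s => c * (-1) ^+ s) j xd.
rewrite -[RHS](mulr0 c) -[X in _ = c * X](bpz_cancellation j xd).
rewrite [X in _ + X](eq_bigr (fun k => \sum_(s : 'S_m) c * ((-1) ^+ s * (pairing_term s x *
    (2 * (x 0 k - x 0 j)^-1 * pole s k x - (x 0 k - x 0 j)^-1 ^+ 2))))) => [|k _]; last first.
  have [_ ->] := is_derive_pairing_sum (fun s => c * (-1) ^+ s) k xd.
  rewrite /pairing_sum !mulr_sumr -sumrB; apply: eq_bigr => s _.
  rewrite -exprVn; move: (pairing_term s x) (pole s k x) ((-1) ^+ s) (_^-1) => P u e d.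
  ring.
rewrite exchange_big /= !mulr_sumr -big_split; apply: eq_bigr => s _ /=.
rewrite -!mulr_sumr; set S := \sum_(_ < _ | _) _.
move: S (pairing_term s x) (pole s j x) ((-1) ^+ s) => S P u e.
by field.
Qed.

Lemma pfaffian_cauchy_pairing_sum x :
  pfaffian (cauchy_mx x) = pairing_sum (fun s => (2 ^+ n * n`!%:R)^-1 * (-1) ^+ s) x.
Proof.
rewrite /pfaffian /pairing_sum mulr_sumr; apply: eq_bigr => s _.
by rewrite pairing_term_cauchy mulrA.
Qed.

End BPZ.

Lemma increasing_distinct (R : realType) n (x : 'rV[R]_(n.*2)) : increasing x -> distinct x.
Proof.
move=> xinc a b; rewrite neq_ltn => /orP[|] /xinc; first by move/lt_eqF => ->.
by move/gt_eqF => ->.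
Qed.

Lemma pfaffian_cauchy_pair_partitions (R : realType) n (x : 'rV[R]_(n.*2)) :
  pfaffian (cauchy_mx x) = pair_partition_sum x.
Proof.
rewrite -[RHS](pfaffian_pair_sum (fun a b : 'I_(n.*2) => (x 0 b - x 0 a)^-1)).
congr pfaffian; apply/matrixP => a b; rewrite !mxE.
by case: ifP => // _; case: ifP => // _; rewrite -invrN opprB.
Qed.

Theorem propositionA1 (R : realType)
  (P_ising : probability (config vertex) R) (hP_ising : half_plane_ising_free P_ising)
  (P_fk : probability (config edge) R) (hP_fk : half_plane_fk_free P_fk)
  (C4 : R) (hC4 : is_C4 P_fk C4)
  (n : nat) (hn : (1 <= n)%N) :
  exists F : 'rV[R]_(n.*2) -> R,
    forall x : 'rV[R]_(n.*2), increasing x ->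
      [/\ forall k : 'I_(n.*2) -> R -> int,
            (forall a : R, 0 < a ->
               forall i j : 'I_(n.*2), (i < j)%N -> (k i a < k j a)) ->
            (forall j : 'I_(n.*2), approximates (k j) (x 0 j)) ->
            scaled_correlation P_ising k a @[a --> 0^'+] --> F x,
          F x = C4 ^+ n * pfaffian (cauchy_mx x),
          F x = C4 ^+ n * pair_partition_sum x &
          forall j : 'I_(n.*2),
            [/\ forall i : 'I_(n.*2), derivable F x 'e_i,
                derivable ('D_('e_j) F) x 'e_j &
                bpz_operator j F x = 0]].
Proof.
(* The constant joins C4^n to the normalisation of the Pfaffian. The witness is an explicit sum over
   permutations, defined for all x, so its derivatives at an increasing x can be computed
   directly. *)
pose c : R := C4 ^+ n * (2 ^+ n * n`!%:R)^-1.
exists (pairing_sum (fun s => c * (-1) ^+ s)) => x xinc.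
have xd := increasing_distinct xinc.
have Fx : pairing_sum (fun s => c * (-1) ^+ s) x = C4 ^+ n * pfaffian (cauchy_mx x).
  rewrite pfaffian_cauchy_pairing_sum mulr_sumr; apply: eq_bigr => s _.
  by rewrite /c !mulrA.
split=> // [k kinc kx||j].
- by rewrite Fx; exact: scaling_limit hP_ising _ hP_fk _ hC4 _ _ _ xinc kinc kx.
- by rewrite Fx pfaffian_cauchy_pair_partitions.
split=> [i||].
- by have [] := is_derive_pairing_sum (fun s => c * (-1) ^+ s) i xd.
- by have [] := is_derive2_pairing_sum (fun s => c * (-1) ^+ s) j xd.
- exact: bpz_pairing_sum.
Qed.
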